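(* Let $M$ be a von Neumann algebra, $M_\star$ its unique predual, and let $\varphi \in M_\star$ be nonzero. Then the following are equivalent: (i) $\varphi$ is the center of a segment of length $2\Vert\varphi\Vert$ in the closed ball of $M_\star$ (centered at $0$) of radius $\Vert\varphi\Vert$. (ii) There is $\psi \in M_\star$ such that $\Vert\varphi+\psi\Vert=\Vert\varphi-\psi\Vert = \Vert\varphi\Vert = \Vert\psi\Vert$. (iii) There are two orthogonal projections $e_+, e_- \in M_{|\varphi|}$ such that $e_+ + e_- = s(|\varphi|)$ and $|\varphi|(e_+) = |\varphi|(e_-) = |\varphi|(s(|\varphi|))/2 = \Vert\varphi\Vert/2$. If (iii) holds, then $\psi$ in (ii) can be chosen to be $v(e_+ - e_-)|\varphi| = \varphi e_+ - \varphi e_-$, where $\varphi=v|\varphi|$ is the polar decomposition of $\varphi$. In particular, the solutions $\psi \in M_\star$ of the norm equation $\Vert\varphi\pm\psi\Vert = \Vert\varphi\Vert = \Vert\psi\Vert$ are given by $\psi = \varphi e_+ - \varphi e_-$ with orthogonal projections $e_+,e_-$ in $M_{|\varphi|}$ satisfying $e_+ + e_- = s(|\varphi|)$ and $|\varphi|(e_+) =|\varphi|(e_-)= \Vert\varphi\Vert/2$.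
   Context: $M_\star$ is identified with the space of weak$^*$-continuous (normal) bounded linear functionals on $M$; its separability is not assumed. For $x\in M$, $\varphi\in M_\star$, define $x\varphi,\varphi x\in M_\star$ by $(x\varphi)(y):=\varphi(yx)$ and $(\varphi x)(y):=\varphi(xy)$ for $y\in M$. The support $s(\omega)$ of a positive $\omega\in M_\star$ is $1-p$, where $p$ is the greatest projection in $M$ with $\omega(p)=0$. Every $\varphi\in M_\star$ has a unique polar decomposition $\varphi=v|\varphi|$ with $|\varphi|\in M_\star$ positive and $v\in M$ a partial isometry with $v^*v=s(|\varphi|)$. For a nonzero positive $\omega\in M_\star$ (not necessarily faithful), the centralizer $M_\omega$ is defined as the centralizer of the faithful restriction of $\omega$ to $s(\omega)Ms(\omega)$: $$M_\omega:=\{x\in s(\omega)Ms(\omega) : \omega(xy)=\omega(yx)\text{ for all }y\in s(\omega)Ms(\omega)\}.$$ *)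

(* Defs.v *)
From HB Require Import structures.
From mathcomp Require Export all_boot all_order all_algebra.
From mathcomp Require Export complex.
From mathcomp Require Export all_classical all_reals all_analysis.
Export Order.TTheory GRing.Theory Num.Theory numFieldNormedType.Exports.

Set Implicit Arguments.
Unset Strict Implicit.
Unset Printing Implicit Defensive.

Local Open Scope classical_set_scope.
Local Open Scope ring_scope.
Local Open Scope complex_scope.

(* MathComp-Analysis norms over R[i] take values in R[i]. *)
Definition rnorm (R : realType) (V : normedModType R[i]) (x : V) : R :=
  complex.Re `|x|.

(* A complex Hilbert space is H : completeNormedModType R[i] together with an
   inner product ip (linear in the first argument) inducing the norm of H. *)
Definition hilbert_norm (R : realType) (H : completeNormedModType R[i])
    (ip : {dot H for @Num.conj R[i]}) : Prop :=
  forall h : H, `|h| ^+ 2 = ip h h.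

Section Operators.
Context (R : realType) (H : completeNormedModType R[i]).
Variable ip : {dot H for @Num.conj R[i]}.

Definition bounded_operator (a : H -> H) : Prop := linear a /\ continuous a.

Definition is_adjoint (a b : H -> H) : Prop :=
  forall h k : H, ip (a h) k = ip h (b k).

Definition adj (a : H -> H) : H -> H := xget 0 [set b | is_adjoint a b].

Definition op_le (a b : H -> H) : Prop :=
  forall h : H, ip (a h) h <= ip (b h) h.

Definition commutant (S : set (H -> H)) : set (H -> H) :=
  [set b | bounded_operator b /\ forall a, S a -> a \o b = b \o a].

Definition von_neumann_algebra (M : set (H -> H)) : Prop :=
  (forall a, M a -> exists2 b, M b & is_adjoint a b) /\
  commutant (commutant M) = M.

(* Closed unit ball of B(H) for the operator norm. *)
Definition contraction (a : H -> H) : Prop := forall h : H, `|a h| <= `|h|.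

Definition is_projection (p : H -> H) : Prop := p \o p = p /\ is_adjoint p p.

Definition partial_isometry (v : H -> H) : Prop := is_projection (adj v \o v).

Definition square_summable (xi : nat -> H) : Prop :=
  cvgn (series (fun n => rnorm (xi n) ^+ 2)).

Definition square_summable_pair : Type :=
  {p : (nat -> H) * (nat -> H) | square_summable p.1 /\ square_summable p.2}.

Definition sigma_weak_eval (a : H -> H) :
    prod_topology (fun _ : square_summable_pair => (R[i])^o) :=
  fun p => limn (series (fun n =>
    ip (a ((sval p).1 n)) ((sval p).2 n) : (R[i])^o)).

(* The sigma-weak topology, which is the weak* topology on a von Neumann
   algebra. Only its trace on the bounded operators is meaningful: elsewhere
   the series above need not converge. *)
Definition sigma_weak : topologicalType := initial_topology sigma_weak_eval.

End Operators.

(* A functional on M is represented by any function on all of H -> H extending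
   it: every notion below depends only on the restriction to M, and equality
   of functionals is eq_on M. *)
Section Functionals.
Context (R : realType) (H : completeNormedModType R[i]).
Variables (ip : {dot H for @Num.conj R[i]}) (M : set (H -> H)).
Implicit Types phi psi omega chi : (H -> H) -> R[i].

Definition eq_on phi psi : Prop := forall x, M x -> phi x = psi x.

Definition linear_on phi : Prop :=
  forall (c : R[i]) x y, M x -> M y -> phi (c *: x + y) = c * phi x + phi y.

Definition ball_values phi : set R :=
  [set rnorm (phi x : (R[i])^o) | x in M `&` [set x | contraction x]].

Definition fnorm phi : R := sup (ball_values phi).

Definition predual phi : Prop :=
  [/\ linear_on phi,
      has_ubound (ball_values phi) &
      {within (M : set (sigma_weak ip)),
         continuous (phi : sigma_weak ip -> (R[i])^o)}].

Definition predual_ball (r : R) : set ((H -> H) -> R[i]) :=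
  [set chi | predual chi /\ fnorm chi <= r].

Definition segment phi psi : set ((H -> H) -> R[i]) :=
  [set (fun x => (1 - t)%:C * phi x + t%:C * psi x) | t in `[0 : R, 1]].

Definition center_of_segment phi psi chi : Prop :=
  eq_on phi (fun x => (psi x + chi x) / 2).

Definition lmul (x : H -> H) phi : (H -> H) -> R[i] := fun y => phi (y \o x).
Definition rmul phi (x : H -> H) : (H -> H) -> R[i] := fun y => phi (x \o y).

Definition positive_functional omega : Prop :=
  forall a, M a -> op_le ip 0 a -> 0 <= omega a.

Definition greatest_null_projection omega (p : H -> H) : Prop :=
  [/\ M p, is_projection ip p, omega p = 0 &
      forall q, M q -> is_projection ip q -> omega q = 0 -> op_le ip q p].

Definition supp omega : H -> H :=
  idfun - xget 0 [set p | greatest_null_projection omega p].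

Definition is_polar_decomposition phi (v : H -> H) omega : Prop :=
  [/\ predual omega, positive_functional omega, M v, partial_isometry ip v &
      adj ip v \o v = supp omega /\ eq_on phi (lmul v omega)].

Definition polar_decomposition phi : (H -> H) * ((H -> H) -> R[i]) :=
  xget (0, 0) [set p | is_polar_decomposition phi p.1 p.2].

Definition phase phi : H -> H := (polar_decomposition phi).1.
Definition absf phi : (H -> H) -> R[i] := (polar_decomposition phi).2.

Definition corner (s : H -> H) : set (H -> H) := [set s \o a \o s | a in M].

Definition centralizer omega : set (H -> H) :=
  [set x | corner (supp omega) x /\
     forall y, corner (supp omega) y -> omega (x \o y) = omega (y \o x)].

Definition centralizer_splitting omega (ep em : H -> H) : Prop :=
  [/\ centralizer omega ep /\ is_projection ip ep,
      centralizer omega em /\ is_projection ip em,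
      ep \o em = 0 &
      ep + em = supp omega].

End Functionals.

(* Main.v *)
(* Idea. Write N for the norm of phi, phi = omega(. v) for its polar
   decomposition and u for the adjoint of v. If ||phi + psi|| = ||phi - psi|| = N,
   both functionals attain their norm at u, since phi(u) = N and the closed disk
   is strictly convex; hence -omega <= chi <= omega for chi = psi(. u). A
   self-adjoint contraction a with chi(a) = N satisfies
   (omega - chi)(1 + a) = (omega + chi)(1 - a) = 0, and the Cauchy-Schwarz
   inequality then forces omega(y (1 +- a)/2) = (omega +- chi)(y)/2
   = omega((1 +- a)/2 y). So (1 +- a)/2 commutes with omega, becomes a projection
   e_+- after compression to the support, and chi = omega(. (e_+ - e_-)).
   Norm attainment and suprema of chains of positive contractions come from weak
   compactness of the unit ball of M, obtained by taking limits along an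
   ultrafilter and representing the limit form by the Riesz lemma. The polar
   decomposition needs no functional calculus: if a contraction x has
   phi(x) = N, then omega = phi(. x) is positive and phi = omega(. v) for v the
   product of the adjoint of x with the support of omega. *)
Require Import Defs.
From mathcomp Require Import ring lra.

Local Open Scope classical_set_scope.
Local Open Scope ring_scope.
Local Open Scope complex_scope.

Set Implicit Arguments.
Unset Strict Implicit.
Unset Printing Implicit Defensive.

(** The field [R[i]] is only partially ordered and its norms are complex numbers, so estimates are
    made for the real part [ipR] of the inner product, which determines [ip] through multiplication
    by ['i]. Normal functionals pass to weak limits because, on contractions, one summable series
    dominates all the series that define the sigma-weak topology. The limit stays in [M] because
    commutation with the commutant can be read off matrix coefficients. A functional attaining its
    norm at a contraction [x] is unchanged when its argument is multiplied on the right by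
    [x^! \o x]. For [phi] this yields the polar decomposition; for [phi + psi] and [phi - psi] at
    [u] it yields psi = chi(. v), so that passing from [psi] to [chi] loses nothing. The value N/2
    is forced: positivity of omega - chi at (1 + a)/2 and of omega + chi at (1 - a)/2 bounds two
    numbers with sum N from below by N/2. Conversely, if e commutes with omega and omega(e) = N/2,
    then phi(e y) = omega(e y v e), and Cauchy-Schwarz bounds it by N/2; this controls phi + psi = 2
    phi(e_+ .) and phi - psi = 2 phi(e_- .). *)

Lemma conjE (R : realType) (z : R[i]) : Num.conj z = conjc z.
Proof. by []. Qed.

(** * Complex numbers and real-valued norms *)

Section Complex.
Context (R : realType).
Implicit Types (z w : R[i]).

Lemma ReZ (c : R) z : complex.Re (c%:C * z) = c * complex.Re z.
Proof. by case: z => a b /=; rewrite mul0r subr0. Qed.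

Lemma complexP z w :
  complex.Re z = complex.Re w -> complex.Im z = complex.Im w -> z = w.
Proof. by case: z => a b; case: w => c d /= -> ->. Qed.

Lemma ger0cE z : (0 <= z) = (complex.Im z == 0) && (0 <= complex.Re z).
Proof. by rewrite lecE. Qed.

Lemma rnormE z : rnorm (z : R[i]^o) =
  Num.sqrt (complex.Re z ^+ 2 + complex.Im z ^+ 2).
Proof. by rewrite /rnorm normc_def. Qed.

Lemma sqr_rnorm z : rnorm (z : R[i]^o) ^+ 2 = complex.Re z ^+ 2 + complex.Im z ^+ 2.
Proof. by rewrite rnormE sqr_sqrtr // addr_ge0 // sqr_ge0. Qed.
End Complex.

Section Rnorm.
Context (R : realType) (V : normedModType R[i]).
Implicit Types (x y : V).

Lemma rnormC x : `|x| = (rnorm x)%:C.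
Proof. by rewrite /rnorm RRe_real // normr_real. Qed.

Lemma rnorm_ge0 x : 0 <= rnorm x.
Proof. by rewrite -ler0c -rnormC. Qed.

Lemma rnormD x y : rnorm (x + y) <= rnorm x + rnorm y.
Proof. by rewrite -lecR rmorphD /= -!rnormC ler_normD. Qed.

Lemma rnormZ c x : rnorm (c *: x) = rnorm (c : R[i]^o) * rnorm x.
Proof. by apply: complexI; rewrite rmorphM /= -!rnormC normrZ. Qed.

Lemma rnormN x : rnorm (- x) = rnorm x.
Proof. by rewrite /rnorm normrN. Qed.

Lemma rnorm0 : rnorm (0 : V) = 0.
Proof. by rewrite /rnorm normr0. Qed.

Lemma ler_rnorm x y : (`|x| <= `|y|) = (rnorm x <= rnorm y).
Proof. by rewrite !rnormC lecR. Qed.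
End Rnorm.

Lemma Re_le_rnorm (R : realType) (z : R[i]) : `|complex.Re z| <= rnorm (z : R[i]^o).
Proof.
rewrite rnormE -sqrtr_sqr ler_sqrt ?lerDl ?sqr_ge0 //.
by rewrite addr_ge0 // sqr_ge0.
Qed.

(** * The real inner product *)

Section Hilbert.
Context (R : realType) (H : completeNormedModType R[i]).
Context (ip : {dot H for @Num.conj R[i]}).

(** Nothing is lost by dropping the imaginary part: it is the real part at ['i%C *: k] (see [ipE]).
    In exchange all inequalities live in the ordered field [R]. *)
Definition ipR (h k : H) : R := complex.Re (ip h k).

Lemma ipRC h k : ipR h k = ipR k h.
Proof.
have -> : ipR h k = complex.Re (conjc (ip k h)).
  by rewrite /ipR (hermC ip h k) mul1r.
by rewrite /ipR; case: (ip k h).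
Qed.

Lemma ipRDl x y z : ipR (x + y) z = ipR x z + ipR y z.
Proof. by rewrite /ipR linearDl raddfD. Qed.
Lemma ipRDr x y z : ipR z (x + y) = ipR z x + ipR z y.
Proof. by rewrite !(ipRC z) ipRDl. Qed.
Lemma ipRZl (c : R) x z : ipR (c%:C *: x) z = c * ipR x z.
Proof. by rewrite /ipR linearZl_LR /= ReZ. Qed.
Lemma ipRZr (c : R) x z : ipR z (c%:C *: x) = c * ipR z x.
Proof. by rewrite !(ipRC z) ipRZl. Qed.
Lemma ipRNl x z : ipR (- x) z = - ipR x z.
Proof. by rewrite /ipR linearNl raddfN. Qed.
Lemma ipRNr x z : ipR z (- x) = - ipR z x.
Proof. by rewrite !(ipRC z) ipRNl. Qed.
Lemma ipRBl x y z : ipR (x - y) z = ipR x z - ipR y z.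
Proof. by rewrite ipRDl ipRNl. Qed.
Lemma ipRBr x y z : ipR z (x - y) = ipR z x - ipR z y.
Proof. by rewrite ipRDr ipRNr. Qed.
Lemma ipR0l z : ipR 0 z = 0. Proof. by rewrite -(subrr 0) ipRBl subrr. Qed.
Lemma ipR0r z : ipR z 0 = 0. Proof. by rewrite ipRC ipR0l. Qed.
Lemma ipR_conj c x y : ipR (c *: x) y = ipR x (c^*%C *: y).
Proof. by rewrite /ipR linearZl_LR linearZr_LR /= conjE conjcK. Qed.
Lemma ipR_i x y : ipR x ('i%C *: y) = complex.Im (ip x y).
Proof.
rewrite /ipR linearZr_LR /=; case: (ip x y) => a b /=.
by rewrite mul0r mulN1r opprK add0r.
Qed.
Lemma ipE x y : ip x y = ipR x y +i* ipR x ('i%C *: y).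
Proof. by rewrite ipR_i /ipR; case: (ip x y). Qed.
Lemma ipR_eqP x y : (forall z, ipR x z = ipR y z) -> x = y.
Proof.
move=> e; apply/eqP; rewrite -subr_eq0 -(dnorm_eq0 ip); apply/eqP.
have e0 z : ipR (x - y) z = 0 by rewrite ipRBl e subrr.
by rewrite ipE !e0.
Qed.
Lemma ipR_eqPr x y : (forall z, ipR z x = ipR z y) -> x = y.
Proof. by move=> e; apply: ipR_eqP => z; rewrite !(ipRC _ z). Qed.

Hypothesis hH : hilbert_norm ip.

Lemma ipRE h : ipR h h = rnorm h ^+ 2.
Proof. by rewrite /ipR -hH rnormC -rmorphXn. Qed.

Lemma ipR_ge0 h : 0 <= ipR h h. Proof. by rewrite ipRE sqr_ge0. Qed.

Lemma ipR_CS h k : `|ipR h k| <= rnorm h * rnorm k.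
Proof.
rewrite -ler_sqr ?nnegrE ?mulr_ge0 ?rnorm_ge0 // real_normK ?num_real //.
rewrite exprMn -!ipRE.
have [->|k0] := eqVneq k 0; first by rewrite !ipR0r expr0n mulr0.
have kp : 0 < ipR k k.
  rewrite lt_neqAle ipR_ge0 andbT eq_sym ipRE sqrf_eq0.
  by apply: contraNneq k0 => r0; rewrite -normr_eq0 rnormC r0.
(* With a = |h|^2, b = |k|^2 and c = [ipR h k], the squared norm of b h - c k is b (a b - c^2). *)
have := ipR_ge0 ((ipR k k)%:C *: h - (ipR h k)%:C *: k).
rewrite ipRBl !ipRBr !ipRZl !ipRZr (ipRC k h).
set a := ipR h h; set b := ipR k k in kp *; set c := ipR h k => e.
have : 0 <= b * (a * b - c ^+ 2).
  by apply: le_trans e _; rewrite le_eqVlt; apply/orP; left; apply/eqP; ring.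
by rewrite pmulr_rge0 // subr_ge0.
Qed.

End Hilbert.

(** * Riesz representation *)

Section Riesz.
Context (R : realType) (H : completeNormedModType R[i]).
Context (ip : {dot H for @Num.conj R[i]}) (hH : hilbert_norm ip).
Local Notation ipR := (ipR ip).

(* The representing vector minimizes [ipR h h - 2 * f h]; any minimizing filter
   is Cauchy by the parallelogram identity. *)
Lemma riesz (f : H -> R) (C : R) :
  (forall x y, f (x + y) = f x + f y) ->
  (forall (c : R) x, f (c%:C *: x) = c * f x) ->
  (forall x, `|f x| <= C * rnorm x) ->
  exists k, forall h, f h = ipR h k.
Proof.
move=> fD fZ fC.
pose J h := ipR h h - 2 * f h.
have Jlb h : - C ^+ 2 <= J h.
  have := fC h; rewrite ler_norml => /andP[_ fh].
  rewrite /J ipRE //; have := sqr_ge0 (rnorm h - C); nra.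
have hasinf : has_inf (range J).
  by split; [exists (J 0), 0 | exists (- C ^+ 2) => _ [h _ <-]].
set m := inf (range J).
have mJ h : m <= J h by apply: ge_inf; [case: hasinf | exists h].
pose A e := [set h | J h < m + e].
pose F := filter_from [set e : R | 0 < e] A.
have FF : ProperFilter F.
  apply: filter_from_proper; last first.
    move=> e /= e0; have : m < m + e by rewrite ltrDl.
    by move/(inf_lt hasinf.1)=> [_ [h _ <-] lt]; exists h.
  apply: filter_from_filter; first by exists 1 => /=.
  move=> e e' /= e0 e'0; exists (Num.min e e'); first by rewrite /= lt_min e0.
  move=> h /= hA; split; apply: lt_le_trans hA _; rewrite lerD2l ge_min lexx ?orbT //.
have Ff : Filter F := @filter_filter _ _ FF.
have close e h k : A e h -> A e k -> rnorm (h - k) ^+ 2 < 4 * e.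
  move=> hA kA; have := mJ (2^-1%:C *: (h + k)).
  move: hA kA; rewrite /A /J /= -(ipRE hH) fZ fD !ipRZl !ipRZr.
  rewrite !(ipRDl, ipRDr, ipRNl, ipRNr) (ipRC ip k h).
  lra.
have cF : cvg F.
  apply: cauchy_cvg; apply: cauchy_exP => eps eps0.
  have epsE : eps = (complex.Re eps)%:C.
    by move: eps0; rewrite ltcE => /andP[/eqP i0 _]; apply: complexP.
  have e0 : 0 < complex.Re eps by rewrite -ltcR -epsE.
  set e := complex.Re eps in epsE e0.
  have e40 : 0 < e ^+ 2 / 4 by rewrite divr_gt0 // exprn_gt0.
  have : F (A (e ^+ 2 / 4)) by exists (e ^+ 2 / 4).
  move=> /[dup] /filter_ex[h Ah] FA; exists h.
  apply: filterS FA => k Ak; rewrite -ball_normE /= epsE rnormC ltcR.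
  have := close _ _ _ Ah Ak; rewrite mulrC divfK // ltr_pXn2r ?nnegrE ?rnorm_ge0 //.
  exact: ltW.
exists (lim F) => g.
(* An approximate minimizer represents [f] approximately: [m] bounds [J] along the line h + t g, so
   a quadratic polynomial in t is nonnegative, and its discriminant gives the estimate. *)
have lin (e : R) (h : H) : 0 < e -> A e h -> (ipR g h - f g) ^+ 2 <= e * ipR g g.
  move=> e0 Ah.
  have key t : 0 <= t ^+ 2 * ipR g g + 2 * t * (ipR g h - f g) + e.
    have := mJ (h + t%:C *: g); move: Ah; rewrite /A /J /= fD fZ.
    rewrite !(ipRDl, ipRDr, ipRZl, ipRZr) (ipRC ip h g); lra.
  have g0 := ipR_ge0 hH g.
  have [gz|gz] := eqVneq (ipR g g) 0.
    rewrite gz mulr0; set b := ipR g h - f g in key *.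
    have [->|b0] := eqVneq b 0; first by rewrite expr0n.
    (* Without a quadratic term the polynomial is 2 t b + e, which equals - e at this t. *)
    have := key (- (e / b)); rewrite gz mulr0 add0r mulrN !mulNr.
    rewrite -!mulrA mulVf // mulr1 -subr_ge0; lra.
  have gp : 0 < ipR g g by rewrite lt_neqAle eq_sym gz.
  have := key (- (ipR g h - f g) / ipR g g).
  set b := ipR g h - f g; set a := ipR g g in gp gz *.
  have -> : (- b / a) ^+ 2 * a + 2 * (- b / a) * b + e = e - b ^+ 2 / a by field.
  by rewrite subr_ge0 ler_pdivrMr.
apply/eqP; rewrite eq_sym -subr_eq0 -normr_le0; apply/ler_addgt0Pr => e e0; rewrite add0r.
(* Two errors of size at most d |g| occur, from replacing the limit by [h] and from [lin]; the 1
   avoids a division by zero. *)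
pose d : R := e / 2 / (rnorm g + 1).
have ng := rnorm_ge0 g.
have g1 : 0 < rnorm g + 1 by apply: ltr_wpDl.
have d0 : 0 < d by rewrite !divr_gt0.
have Fd : F (A (d ^+ 2)) by exists (d ^+ 2) => //=; rewrite exprn_gt0.
have d0C : 0 < d%:C by rewrite ltcR.
have nF : F [set t | `|lim F - t| < d%:C].
  by apply: (@cvgrPdist_lt _ _ _ F _ id (lim F)).1 d0C.

have nFI : F (A (d ^+ 2) `&` [set t | `|lim F - t| < d%:C]) by apply: filterI.
have [h [Ah]] := @filter_ex _ _ FF _ nFI.
rewrite /= rnormC ltcR => hk.
have dd : d * (rnorm g + 1) = e / 2 by rewrite divfK // gt_eqF.
have := lin _ _ (exprn_gt0 2 d0) Ah.
rewrite (ipRE hH) -exprMn -ler_sqrt ?sqr_ge0 // !sqrtr_sqr.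
rewrite (ger0_norm (mulr_ge0 (ltW d0) ng)) => l1.
have l2 := ipR_CS hH g (lim F - h); rewrite ipRBr in l2.
have := ler_normD (ipR g (lim F) - ipR g h) (ipR g h - f g); rewrite addrA subrK.
have := ler_wpM2l ng (ltW hk).
nra.
Qed.

(** The vector is chosen separately for each second argument; linearity or boundedness of the
    resulting operator is read off the form where it is wanted. *)
Lemma riesz_form (f : H -> H -> R) (C : R) :
  (forall x y z, f (x + y) z = f x z + f y z) ->
  (forall (c : R) x z, f (c%:C *: x) z = c * f x z) ->
  (forall x z, `|f x z| <= C * (rnorm x * rnorm z)) ->
  exists b : H -> H, forall h k, f h k = ipR h (b k).
Proof.
move=> fD fZ fC.
have /choice[b hb] : forall k, exists b, forall h, f h k = ipR h b.
  move=> k; apply: (@riesz (f^~ k) (C * rnorm k)) => // x.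
  by rewrite mulrAC -mulrA.
by exists b.
Qed.
End Riesz.

(** * Limits along filters and dominated series *)

Lemma cvg_ler (R : realType) (T : Type) (F : set_system T) {PF : ProperFilter F}
    (f : T -> R) (l c : R) :
  f @ F --> l -> F [set x | f x <= c] -> l <= c.
Proof.
move=> fl fc; rewrite -(cvg_lim (@Rhausdorff R) fl); apply: limr_le => //.
by apply/cvg_ex; exists l.
Qed.

Lemma cvg_ger (R : realType) (T : Type) (F : set_system T) {PF : ProperFilter F}
    (f : T -> R) (l c : R) :
  f @ F --> l -> F [set x | c <= f x] -> c <= l.
Proof.
move=> fl fc; rewrite -(cvg_lim (@Rhausdorff R) fl); apply: limr_ge => //.
by apply/cvg_ex; exists l.
Qed.

Section UltraReal.
Context (R : realType) (T : Type) (U : set_system T) (UU : UltraFilter U).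

(** The image filter has a cluster point in a compact segment, and a cluster point of an ultrafilter
    is a limit: a neighborhood outside the filter would have its complement inside. *)
Lemma ultra_bounded_cvg (f : T -> R) (C : R) :
  U [set x | `|f x| <= C] -> cvg (f @ U).
Proof.
move=> UC.
have PU : ProperFilter U by exact: ultra_proper.
have seg : U (f @^-1` `[- C, C]%classic).
  by apply: (@filterS _ U _ _ _ _ UC) => x /=; rewrite ler_norml in_itv.
have [p [_ clp]] := @segment_compact R (- C) C (f @ U) _ seg.
apply/cvg_ex; exists p => V pV.
have [//|Vc] := in_ultra_setVsetC (f @^-1` V) UU.
by have [y []] := clp (~` V) V Vc pV.
Qed.

Lemma ultra_bounded_lim (f : T -> R) (C : R) :
  U [set x | `|f x| <= C] -> f @ U --> lim (f @ U) /\ `|lim (f @ U)| <= C.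
Proof.
move=> UC; have PU : ProperFilter U by exact: ultra_proper.
have fc : f @ U --> lim (f @ U) by exact: ultra_bounded_cvg UC.
split => //; have nf : `|f x| @[x --> U] --> `|lim (f @ U)| by exact: cvg_norm.
exact: cvg_ler nf _.
Qed.
End UltraReal.

Lemma cvg_complex (R : realType) (T : Type) (F : set_system T) (FF : Filter F)
    (f : T -> R[i]) (l : R[i]) :
  complex.Re (f x) @[x --> F] --> complex.Re l ->
  complex.Im (f x) @[x --> F] --> complex.Im l ->
  (f x : R[i]^o) @[x --> F] --> (l : R[i]^o).
Proof.
move=> /cvgrPdist_lt cR /cvgrPdist_lt cI; apply/cvgrPdist_lt => e e0.
have eE : e = (complex.Re e)%:C.
  by move: e0; rewrite ltcE => /andP[/eqP i0 _]; apply: complexP.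
have r0 : 0 < complex.Re e by rewrite -ltcR -eE.
have r20 : 0 < complex.Re e / 2 by rewrite divr_gt0.
near=> x; rewrite rnormC [ltRHS]eE ltcR.
have /= hR : `|complex.Re l - complex.Re (f x)| < complex.Re e / 2.
  by near: x; apply: cR.
have /= hI : `|complex.Im l - complex.Im (f x)| < complex.Re e / 2.
  by near: x; apply: cI.
rewrite -ltr_sqr ?nnegrE ?rnorm_ge0 ?(ltW r0) //.
rewrite sqr_rnorm !raddfB /=.
set a := complex.Re l - _ in hR *; set b := complex.Im l - _ in hI *.
rewrite -[a ^+ 2]real_normK ?num_real // -[b ^+ 2]real_normK ?num_real //.
have := normr_ge0 a; have := normr_ge0 b; nra.
Unshelve. all: end_near. Qed.

Section Tannery.
Context (R : realType).
Implicit Types (x w : nat -> R).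

Lemma dominated_series x w : cvgn (series w) -> (forall n, `|x n| <= w n) ->
  cvgn (series x) /\
  forall n, `|limn (series x) - series x n| <= limn (series w) - series w n.
Proof.
move=> cw xw; have cx : cvgn (series x).
  apply: (@normed_cvg _ R^o); apply: series_le_cvg cw => n //=.
  exact: le_trans (xw n).
split => // n.
have c1 : `|series x m - series x n| @[m --> \oo] --> `|limn (series x) - series x n|.
  by apply: cvg_norm; apply: cvgB => //; apply: cvg_cst.
have c2 : series w m - series w n @[m --> \oo] --> limn (series w) - series w n.
  by apply: cvgB => //; apply: cvg_cst.
apply: (ler_cvg_to c1 c2); near=> m.
have nm : (n <= m)%N by near: m; exists n.
rewrite !sub_series_geq //; apply: le_trans (ler_norm_sum _ _ _) _.
exact: ler_sum.
Unshelve. all: end_near. Qed.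

(** Dominated convergence for series: the tails are bounded by those of [w] uniformly in [t], and
    the finite sums converge term by term. A general filter is allowed because the limits are later
    taken along ultrafilters. *)
Lemma tannery (T : Type) (F : set_system T) (FF : Filter F)
    (u : T -> nat -> R) (l w : nat -> R) :
  cvgn (series w) -> F [set t | forall n, `|u t n| <= w n] ->
  (forall n, `|l n| <= w n) -> (forall n, u t n @[t --> F] --> l n) ->
  limn (series (u t)) @[t --> F] --> limn (series l).
Proof.
move=> cw uw lw cu; apply/cvgrPdist_lt => e e0.
have e30 : 0 < e / 3 by rewrite divr_gt0.
have [n hn] : exists n, limn (series w) - series w n < e / 3.
  have /cvgrPdist_lt /(_ _ e30) [n _ /(_ n) hn] := cw.
  by exists n; apply: le_lt_trans (hn (leqnn n)); apply: ler_norm.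
have cs : series (u t) n @[t --> F] --> series l n.
  elim: n {hn} => [|n ih].
    rewrite [X in _ --> X](_ : _ = 0); last by rewrite /series /= big_geq.
    rewrite [X in X @ _](_ : _ = fun=> 0); first exact: cvg_cst.
    by apply/funext => t; rewrite /series /= big_geq.
  rewrite seriesSr [X in X @ _](_ : _ = fun t => series (u t) n + u t n).
    exact: cvgD.
  by apply/funext => t; rewrite seriesSr.
move/cvgrPdist_lt : cs => /(_ _ e30) cs.
near=> t.
have ut : forall n, `|u t n| <= w n by near: t.
have [_ /(_ n) h1] := dominated_series cw ut.
have [_ /(_ n) h2] := dominated_series cw lw.
have h3 : `|series l n - series (u t) n| < e / 3 by near: t.
set a := limn (series l) in h2 *; set b := limn (series (u t)) in h1 *.
move: h1 h2 h3; rewrite ltr_norml !ler_norml ltr_norml => /andP[? ?] /andP[? ?] /andP[? ?].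
apply/andP; split; lra.
Unshelve. all: end_near. Qed.
End Tannery.

Lemma quad_discr (R : realFieldType) (a b c : R) : 0 <= c ->
  (forall t, 0 <= a + 2 * t * b + t ^+ 2 * c) -> b ^+ 2 <= a * c.
Proof.
move=> c_ge0 q; have a0 : 0 <= a by have := q 0; rewrite mulr0 mul0r expr0n mul0r !addr0.
have [c0|c0] := eqVneq c 0.
  have [->|b0] := eqVneq b 0; first by rewrite expr0n mulr_ge0 // c0.
  (* At this point the affine function takes the value - a - 2 < 0. *)
  have := q (- (a + 1) / b).
  have -> : a + 2 * (- (a + 1) / b) * b + (- (a + 1) / b) ^+ 2 * c = - a - 2.
    by rewrite c0; field.
  lra.
have c_gt0 : 0 < c by rewrite lt_neqAle eq_sym c0.
have := q (- b / c).
have -> : a + 2 * (- b / c) * b + (- b / c) ^+ 2 * c = a - b ^+ 2 / c by field.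
by rewrite subr_ge0 ler_pdivrMr.
Qed.

(** * Bounded operators and their quadratic forms *)

Section Operators.
Context (R : realType) (H : completeNormedModType R[i]).
Context (ip : {dot H for @Num.conj R[i]}) (hH : hilbert_norm ip).
Local Notation ipR := (ipR ip).
Implicit Types (a b c : H -> H) (h k : H).

Lemma linopD a : linear a -> forall h k, a (h + k) = a h + a k.
Proof. by move=> l h k; have := l 1 h k; rewrite !scale1r. Qed.
Lemma linop0 a : linear a -> a 0 = 0.
Proof.
by move=> l; apply: (addrI (a 0)); rewrite -(linopD l) !addr0.
Qed.
Lemma linopZ a : linear a -> forall (c : R[i]) h, a (c *: h) = c *: a h.
Proof. by move=> l c h; have := l c h 0; rewrite !addr0 (linop0 l) addr0. Qed.
Lemma linopN a : linear a -> forall h, a (- h) = - a h.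
Proof. by move=> l h; rewrite -scaleN1r (linopZ l) scaleN1r. Qed.
Lemma linopB a : linear a -> forall h k, a (h - k) = a h - a k.
Proof. by move=> l h k; rewrite (linopD l) (linopN l). Qed.

Lemma linop_compB a b c : linear a -> a \o (b - c) = (a \o b) - (a \o c).
Proof. by move=> l; apply/funext => h; apply: (linopB l). Qed.

Lemma bounded_operatorP a :
  bounded_operator a <->
  linear a /\ exists C : R, 0 <= C /\ forall h, rnorm (a h) <= C * rnorm h.
Proof.
split=> [[l ca]|[l [C [C0 aC]]]].
  split => //; have /cvgrPdist_lt /(_ 1 ltr01) := ca 0.
  rewrite (linop0 l) => /nbhs_ballP [e /= e0 he].
  have eE : e = (complex.Re e)%:C.
    by move: e0; rewrite ltcE => /andP[/eqP i0 _]; apply: complexP.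
  have r0 : 0 < complex.Re e by rewrite -ltcR -eE.
  set d := complex.Re e in eE r0.
  exists (2 / d); split; first by rewrite divr_ge0 // ltW.
  move=> h; have [->|h0] := eqVneq h 0.
    by rewrite (linop0 l) !rnorm0 mulr0.
  have hp : 0 < rnorm h.
    rewrite lt_neqAle rnorm_ge0 andbT eq_sym.
    by apply: contraNneq h0 => r; rewrite -normr_eq0 rnormC r.
  (* This factor scales [h] to norm d / 2, inside the ball on which the values of [a] have norm
     below 1; hence the constant 2 / d. *)
  have s0 : 0 < d / 2 / rnorm h by rewrite !divr_gt0.
  have sE : rnorm ((d / 2 / rnorm h)%:C : R[i]^o) = d / 2 / rnorm h.
    by rewrite rnormE /= expr0n addr0 sqrtr_sqr ger0_norm // ltW.
  have := he ((d / 2 / rnorm h)%:C *: h).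
  rewrite -ball_normE /= !sub0r !normrN !rnormC eE ltcR -/d rnormZ sE divfK ?gt_eqF //.
  rewrite ltr_pdivrMr // ltr_pMr // ltr1n => /(_ isT).
  rewrite (linopZ l) rnormZ sE -(rmorph1 (real_complex R)) ltcR.
  move=> /ltW lt.
  have -> : rnorm (a h) = d / 2 / rnorm h * rnorm (a h) * (2 / d * rnorm h).
    by field; rewrite !gt_eqF.
  by rewrite ler_piMl // mulr_ge0 ?divr_ge0 // ltW.
split => // x; apply/cvgrPdist_lt => e e0.
have eE : e = (complex.Re e)%:C.
  by move: e0; rewrite ltcE => /andP[/eqP i0 _]; apply: complexP.
have r0 : 0 < complex.Re e by rewrite -ltcR -eE.
have C1 : 0 < C + 1 by apply: ltr_wpDl.
near=> y; rewrite -(linopB l) rnormC [ltRHS]eE ltcR.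
apply: le_lt_trans (aC _) _.
have : rnorm (x - y) < complex.Re e / (C + 1).
  rewrite -ltcR -rnormC; near: y; apply: cvgr_dist_lt; first exact: cvg_id.
  by rewrite ltcR divr_gt0.
rewrite ltr_pdivlMr //; have := rnorm_ge0 (x - y); nra.
Unshelve. all: end_near. Qed.

Lemma conj_i : ('i%C : R[i])^*%C = - 'i%C.
Proof. by apply: complexP; rewrite /= ?oppr0. Qed.

Lemma is_adjointE a b : is_adjoint ip a b ->
  forall h k, ipR (a h) k = ipR h (b k).
Proof. by move=> ab h k; rewrite /ipR ab. Qed.

(** The imaginary part is the real part with a factor ['i] in the second argument. Since [b] is not
    assumed linear, this factor is moved through [a] instead. *)
Lemma is_adjointP a b : linear a ->
  (forall h k, ipR (a h) k = ipR h (b k)) -> is_adjoint ip a b.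
Proof.
move=> l ab h k; rewrite !ipE ab; congr (_ +i* _).
by rewrite -[in LHS](conjcK 'i%C) -ipR_conj -(linopZ l) ab ipR_conj conjcK.
Qed.

Lemma adj_uniq a b b' : is_adjoint ip a b -> is_adjoint ip a b' -> b = b'.
Proof.
move=> ab ab'; apply/funext => k; apply: (ipR_eqPr (ip := ip)) => h.
by rewrite -(is_adjointE ab) (is_adjointE ab').
Qed.

Lemma adjE a b : is_adjoint ip a b -> adj ip a = b.
Proof.
move=> ab; apply: (@adj_uniq a) => //.
exact: (@xgetPex _ 0 [set b | is_adjoint ip a b] (ex_intro _ b ab)).
Qed.

Lemma is_adjointC a b : is_adjoint ip a b -> is_adjoint ip b a.
Proof.
move=> ab h k; rewrite (hermC ip) (hermC ip h) /= ab.
by rewrite !mul1r.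
Qed.

(** Elements of [M] have adjoints by definition; this lemma supplies them for the commutant, where
    the weak limit argument needs them. *)
Lemma bounded_operator_adjoint a : bounded_operator a ->
  exists b, is_adjoint ip a b.
Proof.
case/bounded_operatorP => l [C [C0 aC]].
have [x y z|c x z|x z|b ab] := @riesz_form R H ip hH (fun h k => ipR (a h) k) C.
- by rewrite (linopD l) ipRDl.
- by rewrite (linopZ l) ipRZl.
- apply: le_trans (ipR_CS hH _ _) _.
  by rewrite mulrA ler_wpM2r // rnorm_ge0.
by exists b; apply: is_adjointP.
Qed.

Lemma rnorm_le_dr (c : R) h k : 0 <= c ->
  ipR h h <= c ^+ 2 * ipR k k -> rnorm h <= c * rnorm k.
Proof.
move=> c0; rewrite !(ipRE hH) -exprMn ler_sqr ?nnegrE ?mulr_ge0 ?rnorm_ge0 //.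
Qed.

Lemma contractionE a : contraction a <-> forall h, ipR (a h) (a h) <= ipR h h.
Proof.
split=> ca h.
  have := ca h; rewrite ler_rnorm !(ipRE hH) => le.
  by rewrite ler_sqr ?nnegrE ?rnorm_ge0.
by rewrite ler_rnorm -[leRHS]mul1r; apply: rnorm_le_dr; rewrite // expr1n mul1r.
Qed.

(* Real parts do not see whether [ip (a h) h] is real, so symmetry is required
   explicitly. *)
Definition posop a :=
  (forall h k, ipR (a h) k = ipR h (a k)) /\ forall h, 0 <= ipR (a h) h.

Lemma op_le0P a : linear a -> op_le ip 0 a <-> posop a.
Proof.
move=> l; split=> [p|[sa p] h]; last first.
  rewrite [ip (0 h) h](_ : _ = 0); last by rewrite /= linear0l.
  rewrite ger0cE ipE /= p andbT; apply/eqP.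
  (* Symmetry makes the imaginary part of [ip (a h) h] equal to its own negative. *)
  have e : ipR (a h) ('i%C *: h) = - ipR (a h) ('i%C *: h).
    by rewrite {1}sa (linopZ l) ipRC ipR_conj conj_i scaleNr ipRNr.
  lra.
have {}p h : 0 <= ip (a h) h.
  by have := p h; rewrite [ip (0 h) h](_ : _ = 0) // /= linear0l.
have q h : ipR (a h) ('i%C *: h) = 0.
  by have := p h; rewrite ger0cE ipE /= => /andP[/eqP].
split; last by move=> h; have := p h; rewrite ger0cE ipE /= => /andP[].
(* Polarization of [q] at h + k. Replacing [k] by ['i%C *: k] then turns this antisymmetry into the
   symmetry of [a]. *)
have q2 h k : ipR (a h) ('i%C *: k) = - ipR (a k) ('i%C *: h).
  have := q (h + k); rewrite (linopD l) scalerDr !(ipRDl, ipRDr) !q; lra.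
move=> h k; have := q2 h ('i%C *: k).
rewrite scalerA -expr2 sqr_i scaleN1r ipRNr (linopZ l) ipR_conj scalerA.
rewrite conj_i mulNr -expr2 sqr_i opprK.
by move=> /oppr_inj ->; rewrite scale1r ipRC.
Qed.

Lemma posop_CS a : linear a -> posop a ->
  forall h k, ipR (a h) k ^+ 2 <= ipR (a h) h * ipR (a k) k.
Proof.
move=> l [sa p] h k; apply: quad_discr => // t.
have := p (h + t%:C *: k).
rewrite (linopD l) (linopZ l) !(ipRDl, ipRDr, ipRZl, ipRZr) (sa k h) (ipRC ip k) => q.
by apply: le_trans q _; rewrite le_eqVlt; apply/orP; left; apply/eqP; ring.
Qed.

Definition unitop a := posop a /\ forall h, ipR (a h) h <= ipR h h.

(** No square root is needed for a^2 <= a: [posop_CS] at [h] and [a h] gives |a h|^4 <= (a h, h) (a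
    a h, a h), and the last factor is at most |a h|^2. *)
Lemma unitop_sqr a : linear a -> unitop a ->
  forall h, ipR (a h) (a h) <= ipR (a h) h.
Proof.
move=> l [p le] h; have := posop_CS l p h (a h).
have := le (a h); have := p.2 h; have := ipR_ge0 hH (a h).
set x := ipR (a h) h; set y := ipR (a h) (a h); set z := ipR _ (a h) => y0 x0 zy xz.
have [->//|yn] := eqVneq y 0.
have yp : 0 < y by rewrite lt_neqAle eq_sym yn.
rewrite -(ler_pM2r yp) -expr2; apply: le_trans xz _; exact: ler_wpM2l.
Qed.

Lemma unitop_contraction a : linear a -> unitop a -> contraction a.
Proof.
move=> l u; apply/contractionE => h.
by apply: le_trans (unitop_sqr l u h) _; case: u.
Qed.

Lemma posop_eq0 a h : linear a -> posop a -> ipR (a h) h = 0 -> a h = 0.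
Proof.
move=> l p e; apply: (ipR_eqP (ip := ip)) => k; rewrite ipR0l.
have := posop_CS l p h k; rewrite e mul0r => z.
by apply/eqP; rewrite -sqrf_eq0 eq_le z sqr_ge0.
Qed.

Lemma ipR_eq0 h : ipR h h = 0 -> h = 0.
Proof.
move=> e; apply/eqP; rewrite -normr_eq0 rnormC.
by have /eqP := e; rewrite (ipRE hH) sqrf_eq0 => /eqP ->.
Qed.
End Operators.

(** * The unit ball of a von Neumann algebra *)

Section VonNeumannAlgebra.
Context (R : realType) (H : completeNormedModType R[i]).
Context (ip : {dot H for @Num.conj R[i]}) (hH : hilbert_norm ip).
Context (M : set (H -> H)) (hM : von_neumann_algebra ip M).
Local Notation ipR := (ipR ip).
Local Notation "a ^!" := (adj ip a).
Implicit Types (a b c : H -> H) (h k : H).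

Lemma vn_bounded a : M a -> bounded_operator a.
Proof. by move=> Ma; move: (Ma); rewrite -hM.2 => -[]. Qed.

Lemma vn_linear a : M a -> linear a.
Proof. by case/vn_bounded. Qed.

Lemma vn_commute a c : M a -> commutant M c -> forall h, c (a h) = a (c h).
Proof. by move=> Ma [_ cc] h; have /(congr1 (@^~ h)) /= -> := cc _ Ma. Qed.

(** The bicommutant identity acts as a membership test, so that closure under sums, products and
    weak limits reduces to commutation relations. *)
Lemma vn_intro a : bounded_operator a ->
  (forall c, commutant M c -> forall h, c (a h) = a (c h)) -> M a.
Proof.
move=> ba ca; rewrite -hM.2; split => // c cc; apply/funext => h /=.
exact: ca.
Qed.

Lemma vn_id : M idfun.
Proof.
apply: vn_intro => //; apply/bounded_operatorP; split => //.
by exists 1; split => // h; rewrite mul1r.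
Qed.

Lemma vn_comp a b : M a -> M b -> M (a \o b).
Proof.
move=> Ma Mb; apply: vn_intro => [|c cc h /=]; last first.
  by rewrite (vn_commute Ma cc) (vn_commute Mb cc).
have /bounded_operatorP[la [C [C0 aC]]] := vn_bounded Ma.
have /bounded_operatorP[lb [D [D0 bD]]] := vn_bounded Mb.
apply/bounded_operatorP; split => [x u v /=|]; first by rewrite lb la.
exists (C * D); split=> [|h /=]; first exact: mulr_ge0.
by apply: le_trans (aC _) _; rewrite -mulrA ler_wpM2l.
Qed.

Lemma vn_lin (x : R[i]) a b : M a -> M b -> M (x *: a + b).
Proof.
move=> Ma Mb; have la := vn_linear Ma; have lb := vn_linear Mb.
apply: vn_intro => [|c cc h]; last first.
  have lc : linear c by case: cc => -[].
  rewrite /= [(x *: a + b) h]/(x *: a h + b h) lc.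
  by rewrite (vn_commute Ma cc) (vn_commute Mb cc).
have /bounded_operatorP[_ [C [C0 aC]]] := vn_bounded Ma.
have /bounded_operatorP[_ [D [D0 bD]]] := vn_bounded Mb.
apply/bounded_operatorP; split => [y u v|].
  rewrite [(x *: a + b) _]/(x *: a _ + b _) [X in _ = _ *: X + _]/(x *: a _ + b _).
  rewrite [X in _ = _ + X]/(x *: a _ + b _) la lb !scalerDr !scalerA (mulrC x).
  by rewrite addrACA.
exists (rnorm (x : R[i]^o) * C + D); split=> [|h].
  by rewrite addr_ge0 // mulr_ge0 // rnorm_ge0.
rewrite [(x *: a + b) h]/(x *: a h + b h); apply: le_trans (rnormD _ _) _.
by rewrite mulrDl lerD // rnormZ -mulrA ler_wpM2l // rnorm_ge0.
Qed.

Lemma vn_add a b : M a -> M b -> M (a + b).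
Proof. by move=> Ma Mb; rewrite -[a]scale1r; apply: vn_lin. Qed.
Lemma vn_opp a : M a -> M (- a).
Proof.
move=> Ma; have := vn_lin (- 1 - 1) Ma Ma; rewrite -{2}[a]scale1r -scalerDl.
by rewrite subrK scaleN1r.
Qed.
Lemma vn_sub a b : M a -> M b -> M (a - b).
Proof. by move=> Ma Mb; apply: vn_add => //; apply: vn_opp. Qed.
Lemma vn_0 : M 0.
Proof. by rewrite -(subrr (idfun : H -> H)); apply: vn_sub; apply: vn_id. Qed.
Lemma vn_scale x a : M a -> M (x *: a).
Proof. by move=> Ma; rewrite -[_ *: _]addr0; apply: vn_lin => //; apply: vn_0. Qed.

Lemma vn_adjoint a : M a -> is_adjoint ip a a^!.
Proof. by move=> Ma; have [b Mb ab] := hM.1 _ Ma; rewrite (adjE ab). Qed.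
Lemma vn_adj a : M a -> M a^!.
Proof. by move=> Ma; have [b Mb ab] := hM.1 _ Ma; rewrite (adjE ab). Qed.
Lemma vn_adjK a : M a -> a^!^! = a.
Proof. by move=> Ma; apply: adjE; apply: is_adjointC; apply: vn_adjoint. Qed.
Lemma ipR_adj a : M a -> forall h k, ipR (a h) k = ipR h (a^! k).
Proof. by move=> Ma h k; apply: is_adjointE; apply: vn_adjoint. Qed.
Lemma ipR_adjr a : M a -> forall h k, ipR h (a k) = ipR (a^! h) k.
Proof. by move=> Ma h k; rewrite ipRC (ipR_adj Ma) ipRC. Qed.
Lemma adj_eq a b : M a -> (forall h k, ipR (a h) k = ipR h (b k)) -> a^! = b.
Proof. by move=> Ma ab; apply: adjE; apply: is_adjointP => //; apply: vn_linear. Qed.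
Lemma adj_id : (idfun : H -> H)^! = idfun.
Proof. by apply: adj_eq => //; apply: vn_id. Qed.
Lemma adj_comp a b : M a -> M b -> (a \o b)^! = b^! \o a^!.
Proof.
move=> Ma Mb; apply: adj_eq => [|h k /=]; first exact: vn_comp.
by rewrite (ipR_adj Ma) (ipR_adj Mb).
Qed.
Lemma adj_lin x a b : M a -> M b -> (x *: a + b)^! = x^*%C *: a^! + b^!.
Proof.
move=> Ma Mb; apply: adj_eq => [|h k]; first exact: vn_lin.
rewrite [(x *: a + b) h]/(x *: a h + b h).
rewrite [(_ *: a^! + b^!) k]/(_ *: a^! k + b^! k) ipRDl ipRDr ipR_conj.
rewrite (ipR_adj Ma) (ipR_adj Mb) (linopZ (vn_linear (vn_adj Ma))).
by [].
Qed.
Lemma adj_add a b : M a -> M b -> (a + b)^! = a^! + b^!.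
Proof.
by move=> Ma Mb; rewrite -{1}[a]scale1r adj_lin // rmorph1 scale1r.
Qed.
Lemma adj_scale x a : M a -> (x *: a)^! = x^*%C *: a^!.
Proof.
move=> Ma; apply: adj_eq => [|h k]; first exact: vn_scale.
rewrite [(x *: a) h]/(x *: a h) [(_ *: a^!) k]/(_ *: a^! k) ipR_conj (ipR_adj Ma).
by rewrite (linopZ (vn_linear (vn_adj Ma))).
Qed.
Lemma vn_commutant_adj c : commutant M c ->
  exists d, (forall h k, ipR (c h) k = ipR h (d k)).
Proof.
move=> [bc _]; have [d cd] := bounded_operator_adjoint hH bc.
by exists d => h k; apply: is_adjointE.
Qed.

(** Weak compactness of the unit ball: each matrix coefficient is bounded, hence convergent along
    the ultrafilter, and the limits form a bounded form represented by an operator. *)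
Lemma ultra_weak_limit (U : set_system (H -> H)) : UltraFilter U ->
  U (M `&` [set a | contraction a]) ->
  exists a, [/\ M a, contraction a &
    forall h k, ipR (b h) k @[b --> U] --> ipR (a h) k].
Proof.
move=> UU UM; have PU : ProperFilter U by exact: ultra_proper.
have bnd h k : U [set b | `|ipR (b h) k| <= rnorm h * rnorm k].
  apply: (filterS _ UM) => b [_ cb] /=; apply: le_trans (ipR_CS hH _ _) _.
  by rewrite ler_wpM2r ?rnorm_ge0 // -ler_rnorm.
have key h k := ultra_bounded_lim UU (bnd h k).
(* The arguments are exchanged because [riesz_form] places the operator in the second slot of
   [ipR]. *)
pose f k h := lim (ipR (b h) k @[b --> U]).
have fc h k : ipR (b h) k @[b --> U] --> f k h by have [] := key h k.
have [x y z|x y z|x z|a aE] := @riesz_form R H ip hH f 1.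
- apply: (@cvg_lim _ (@Rhausdorff R)).
  rewrite [X in X @ _](_ : _ = fun b => ipR (b z) x + ipR (b z) y).
    by apply: cvgD; apply: fc.
  by apply/funext => b; rewrite ipRDr.
- apply: (@cvg_lim _ (@Rhausdorff R)).
  rewrite [X in X @ _](_ : _ = fun b => x * ipR (b z) y).
    by apply: cvgMr; apply: fc.
  by apply/funext => b; rewrite ipRZr.
- by rewrite mul1r mulrC; have [] := key z x.
have fa h k : ipR (b h) k @[b --> U] --> ipR (a h) k.
  by have := fc h k; rewrite aE ipRC.
have lin_a : linear a.
  move=> x u v; apply: (ipR_eqP (ip := ip)) => z.
  rewrite ipRDl ipR_conj.
  have c1 : ipR (b (x *: u + v)) z @[b --> U] -->
      ipR (a u) (x^*%C *: z) + ipR (a v) z.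
    have : ipR (b u) (x^*%C *: z) + ipR (b v) z @[b --> U] -->
      ipR (a u) (x^*%C *: z) + ipR (a v) z by apply: cvgD; apply: fa.
    apply: cvg_trans; apply: near_eq_cvg.
    apply: (filterS _ UM) => b [Mb _] /=.
    by rewrite (vn_linear Mb) ipRDl ipR_conj.
  exact: (cvg_unique (@Rhausdorff R) (fa _ _) c1).
have con_a : contraction a.
  move=> h; rewrite ler_rnorm.
  have : `|ipR (a h) (a h)| <= rnorm h * rnorm (a h).
    by have [_] := key h (a h); rewrite -/(f _ _) aE.
  rewrite (ipRE hH) ger0_norm ?sqr_ge0 // expr2 => le.
  have [->|n0] := eqVneq (rnorm (a h)) 0; first exact: rnorm_ge0.
  by rewrite -(@ler_pM2r _ (rnorm (a h))) // lt_neqAle eq_sym n0 rnorm_ge0.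
exists a; split => //.
apply: vn_intro => [|c cc h].
  apply/bounded_operatorP; split => //; exists 1; split => // h.
  by rewrite mul1r -ler_rnorm.
(* Moving [c] to the other side as [d] expresses both sides of the commutation by matrix
   coefficients of [b], which converge to those of [a]. *)
have [d cd] := vn_commutant_adj cc.
apply: (ipR_eqP (ip := ip)) => k; rewrite cd.
apply: (cvg_unique (@Rhausdorff R) (fa h (d k))).
apply: cvg_trans (fa (c h) k); apply: near_eq_cvg.
apply: (filterS _ UM) => b [Mb _] /=.
by rewrite -cd (vn_commute Mb cc).
Qed.
End VonNeumannAlgebra.

(** * Normal functionals *)

Lemma cvg_initialP (S : choiceType) (T : topologicalType) (f : S -> T)
    (F : set_system S) (FF : Filter F) (s : S) :
  F --> (s : initial_topology f) <-> f x @[x --> F] --> f s.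
Proof.
split=> [Fs|Fs A /= [_ [[B Bop <-] Bfs sBA]]].
  by apply: cvg_trans (@initial_continuous S T f s); apply: cvg_app.
have /Fs FB : nbhs (f s) B by rewrite nbhsE; exists B.
exact: (@filterS _ F FF (f @^-1` B) A sBA FB).
Qed.

Lemma cvg_prod_topologyP (I : Type) (T : I -> topologicalType)
    (F : set_system (prod_topology T)) (FF : Filter F) (t : prod_topology T) :
  F --> t <-> forall i, g i @[g --> F] --> t i.
Proof.
split=> [/cvg_sup Ft i|Ft].
  by have /cvg_initialP := Ft i.
apply/cvg_sup => i.
exact/(@cvg_initialP _ _ (fun f : (forall i, T i) => f i)).
Qed.

Section SigmaWeak.
Context (R : realType) (H : completeNormedModType R[i]).
Context (ip : {dot H for @Num.conj R[i]}) (hH : hilbert_norm ip).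
Local Notation ipR := (ipR ip).
Implicit Types (a b : H -> H).

Lemma sigma_weak_cvgP (F : set_system (H -> H)) (FF : Filter F) a :
  F --> (a : sigma_weak ip) <->
  forall p, sigma_weak_eval ip b p @[b --> F] --> sigma_weak_eval ip a p.
Proof.
split=> [/cvg_initialP Fa|Fa].
  exact: ((cvg_prod_topologyP _ _).1 Fa).
by apply/cvg_initialP; apply/cvg_prod_topologyP.
Qed.

Lemma square_summable_dom (xi eta : nat -> H) :
  square_summable xi -> square_summable eta ->
  cvgn (series (fun n => rnorm (xi n) ^+ 2 + rnorm (eta n) ^+ 2)).
Proof.
move=> sx se; have -> : (fun n => rnorm (xi n) ^+ 2 + rnorm (eta n) ^+ 2) =
  (fun n => rnorm (xi n) ^+ 2) + (fun n => rnorm (eta n) ^+ 2) by [].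
by rewrite seriesD; apply: is_cvgD.
Qed.

(** The bound is independent of [a], so that one summable series dominates the matrix coefficients
    of all contractions at once. *)
Lemma ipR_dom a h k : contraction a ->
  `|ipR (a h) k| <= rnorm h ^+ 2 + rnorm k ^+ 2.
Proof.
move=> ca; apply: le_trans (ipR_CS hH _ _) _.
have := ca h; rewrite ler_rnorm; have := rnorm_ge0 (a h); have := rnorm_ge0 k.
set x := rnorm (a h); set y := rnorm k; set z := rnorm h.
have := sqr_ge0 (z - y); have := sqr_ge0 y; have := sqr_ge0 z; nra.
Qed.

Lemma rnorm_i h : rnorm ('i%C *: h : H) = rnorm h.
Proof. by rewrite rnormZ rnormE /= expr0n add0r expr1n sqrtr1 mul1r. Qed.

Lemma sigma_weak_evalE a p : contraction a -> sigma_weak_eval ip a p =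
  limn (series (fun n => ipR (a ((sval p).1 n)) ((sval p).2 n))) +i*
  limn (series (fun n => ipR (a ((sval p).1 n)) ('i%C *: (sval p).2 n))).
Proof.
move=> ca; case: p => -[xi eta] [/= sx se].
have cw := square_summable_dom sx se.
rewrite /sigma_weak_eval /=; apply: cvg_lim; first exact: norm_hausdorff.
have [c1 _] := dominated_series cw (fun n => ipR_dom (xi n) (eta n) ca).
have [|c2 _] := @dominated_series R (fun n => ipR (a (xi n)) ('i%C *: eta n)) _ cw.
  by move=> n; rewrite -(rnorm_i (eta n)); apply: ipR_dom.
apply: cvg_complex => /=.
  apply: cvg_trans c1; apply: near_eq_cvg; apply: nearW => n.
  by rewrite /series /= raddf_sum.
apply: cvg_trans c2; apply: near_eq_cvg; apply: nearW => n.
by rewrite /series /= raddf_sum; apply: eq_bigr => i _; rewrite ipR_i.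
Qed.

(** On the unit ball, weak convergence already implies sigma-weak convergence, by [tannery] with the
    dominating series of [ipR_dom]. *)
Lemma weak_sigma_weak (F : set_system (H -> H)) (FF : Filter F) a :
  F [set b | contraction b] -> contraction a ->
  (forall h k, ipR (b h) k @[b --> F] --> ipR (a h) k) ->
  F --> (a : sigma_weak ip).
Proof.
move=> Fc ca Fa; apply/sigma_weak_cvgP => -[[xi eta] [/= sx se]].
have cw := square_summable_dom sx se.
rewrite sigma_weak_evalE //=.
(* Applied to [eta] for the real part and to ['i%C *: eta] for the imaginary part; both sequences
   have the same norms. *)
have key (et : nat -> H) : (forall n, rnorm (et n) = rnorm (eta n)) ->
    limn (series (fun n => ipR (b (xi n)) (et n))) @[b --> F] -->
    limn (series (fun n => ipR (a (xi n)) (et n))).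
  move=> ee; apply: (@tannery R (H -> H) F FF (fun b n => ipR (b (xi n)) (et n)) _ _ cw) => //.
    by apply: filterS Fc => b cb n; rewrite -ee; apply: ipR_dom.
  by move=> n; rewrite -ee; apply: ipR_dom.
apply: cvg_complex => /=.
  apply: cvg_trans (key eta _); last by [].
  apply: near_eq_cvg; apply: filterS Fc => b cb; by rewrite sigma_weak_evalE.
apply: cvg_trans (key (fun n => 'i%C *: eta n) _); last by move=> n; rewrite rnorm_i.
by apply: near_eq_cvg; apply: filterS Fc => b cb; rewrite sigma_weak_evalE.
Qed.
End SigmaWeak.

Section Predual.
Context (R : realType) (H : completeNormedModType R[i]).
Context (ip : {dot H for @Num.conj R[i]}) (hH : hilbert_norm ip).
Context (M : set (H -> H)) (hM : von_neumann_algebra ip M).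
Local Notation ipR := (ipR ip).
Local Notation "a ^!" := (adj ip a).
Local Notation norm := (fnorm M).
Implicit Types (a b x y : H -> H) (phi psi : (H -> H) -> R[i]).

Lemma linear_onD phi : linear_on M phi ->
  forall x y, M x -> M y -> phi (x + y) = phi x + phi y.
Proof. by move=> l x y Mx My; have := l 1 x y Mx My; rewrite scale1r mul1r. Qed.
Lemma linear_on0 phi : linear_on M phi -> phi 0 = 0.
Proof.
move=> l; have M0 := vn_0 hM; apply: (addrI (phi 0)).
by rewrite -(linear_onD l) // !addr0.
Qed.
Lemma linear_onZ phi : linear_on M phi ->
  forall (c : R[i]) x, M x -> phi (c *: x) = c * phi x.
Proof.
move=> l c x Mx; have := l c x 0 Mx (vn_0 hM).
by rewrite !addr0 (linear_on0 l) addr0.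
Qed.
Lemma linear_onN phi : linear_on M phi -> forall x, M x -> phi (- x) = - phi x.
Proof. by move=> l x Mx; rewrite -scaleN1r (linear_onZ l) // mulN1r. Qed.
Lemma linear_onB phi : linear_on M phi ->
  forall x y, M x -> M y -> phi (x - y) = phi x - phi y.
Proof.
by move=> l x y Mx My; rewrite (linear_onD l) ?(linear_onN l) //; apply: (vn_opp hM).
Qed.

Lemma predual_linear phi : predual ip M phi -> linear_on M phi.
Proof. by case. Qed.

Lemma predual_cvg phi (F : set_system (H -> H)) (FF : Filter F) a :
  predual ip M phi -> F M -> M a -> F --> (a : sigma_weak ip) ->
  (phi b : R[i]^o) @[b --> F] --> (phi a : R[i]^o).
Proof.
case=> _ _ /subspace_continuousP c FM Ma Fa.
apply: cvg_trans (c a Ma); apply: cvg_app.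
move=> A /= /Fa; rewrite /nbhs /= => FA.
by apply: filterS (filterI FM FA) => b [Mb]; apply.
Qed.

Lemma contraction0 : contraction (0 : H -> H).
Proof. by move=> h; rewrite [(0 : H -> H) h]/(0 : H) normr0. Qed.
Lemma contraction_comp a b : contraction a -> contraction b -> contraction (a \o b).
Proof. by move=> ca cb h; apply: le_trans (ca _) (cb _). Qed.

Lemma ball_valuesP phi (C : R) :
  (forall x, M x -> contraction x -> rnorm (phi x : R[i]^o) <= C) ->
  ubound (ball_values M phi) C.
Proof. by move=> h _ [x [Mx cx] <-]; apply: h. Qed.

Lemma ball_values_nonempty phi : ball_values M phi !=set0.
Proof.
exists (rnorm (phi 0 : R[i]^o)); exists 0 => //.
split; [exact: (vn_0 hM) | exact: contraction0].
Qed.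

Lemma fnorm_le phi (C : R) :
  (forall x, M x -> contraction x -> rnorm (phi x : R[i]^o) <= C) ->
  norm phi <= C.
Proof. by move=> /ball_valuesP; apply: ge_sup; apply: ball_values_nonempty. Qed.

Lemma le_fnorm phi : predual ip M phi ->
  forall x, M x -> contraction x -> rnorm (phi x : R[i]^o) <= norm phi.
Proof. by case=> _ ub _ x Mx cx; apply: ub_le_sup => //; exists x. Qed.

Lemma fnorm_ge0 phi : predual ip M phi -> 0 <= norm phi.
Proof.
move=> p; apply: le_trans (le_fnorm p (vn_0 hM) contraction0).
exact: rnorm_ge0.
Qed.

Lemma fnorm_eq phi psi : eq_on M phi psi -> norm phi = norm psi.
Proof.
move=> e; congr sup; apply/seteqP; split => _ [x [Mx cx] <-]; exists x => //=.
  by rewrite e.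
by rewrite e.
Qed.

Lemma predual_intro phi (C : R) : linear_on M phi ->
  (forall x, M x -> contraction x -> rnorm (phi x : R[i]^o) <= C) ->
  (forall a, M a ->
    (phi b : R[i]^o) @[b --> within M (nbhs (a : sigma_weak ip))] --> (phi a : R[i]^o)) ->
  predual ip M phi.
Proof.
move=> l ub c; split => //; first by exists C; apply: ball_valuesP.
exact/subspace_continuousP.
Qed.

Lemma predual_within phi : predual ip M phi -> forall a, M a ->
  (phi b : R[i]^o) @[b --> within M (nbhs (a : sigma_weak ip))] --> (phi a : R[i]^o).
Proof. by case=> _ _ /subspace_continuousP. Qed.

Lemma predual_eq phi psi : eq_on M phi psi -> predual ip M phi -> predual ip M psi.
Proof.
move=> e p; apply: (@predual_intro _ (norm phi)) => [c x y Mx My|x Mx cx|a Ma].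
- by rewrite -!e ?(predual_linear p) //; apply: (vn_lin hM).
- by rewrite -e // le_fnorm.
- rewrite -e //; apply: cvg_trans (predual_within p Ma).
  by apply: near_eq_cvg; apply: filterS (withinT M _) => b Mb; rewrite e.
Qed.

Lemma rnormM (c d : R[i]) :
  rnorm (c * d : R[i]^o) = rnorm (c : R[i]^o) * rnorm (d : R[i]^o).
Proof. exact: (@rnormZ R R[i]^o c d). Qed.

Lemma predual_lin (c d : R[i]) phi psi : predual ip M phi -> predual ip M psi ->
  predual ip M (fun x => c * phi x + d * psi x).
Proof.
move=> p q; apply: (@predual_intro _
  (rnorm (c : R[i]^o) * norm phi + rnorm (d : R[i]^o) * norm psi)).
- move=> e x y Mx My; rewrite (predual_linear p) // (predual_linear q) //.
  by ring.
- move=> x Mx cx; apply: le_trans (@rnormD R R[i]^o _ _) _.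
  by rewrite !rnormM lerD // ler_wpM2l ?rnorm_ge0 // le_fnorm.
- move=> a Ma; apply: (@cvgD _ R[i]^o).
    exact: (@cvgMr _ _ _ _ (phi : _ -> R[i]^o) c _ (predual_within p Ma)).
  exact: (@cvgMr _ _ _ _ (psi : _ -> R[i]^o) d _ (predual_within q Ma)).
Qed.

Lemma predual_add phi psi : predual ip M phi -> predual ip M psi ->
  predual ip M (phi \+ psi).
Proof.
move=> p q; apply: predual_eq (predual_lin 1 1 p q) => x _ /=.
by rewrite !mul1r.
Qed.
Lemma predual_sub phi psi : predual ip M phi -> predual ip M psi ->
  predual ip M (phi \- psi).
Proof.
move=> p q; apply: predual_eq (predual_lin 1 (- 1) p q) => x _ /=.
by rewrite mul1r mulN1r.
Qed.

Lemma square_summable_contraction a (xi : nat -> H) : contraction a ->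
  square_summable xi -> square_summable (a \o xi).
Proof.
move=> ca sx; apply: series_le_cvg sx => n /=; rewrite ?sqr_ge0 //.
by rewrite ler_sqr ?nnegrE ?rnorm_ge0 // -ler_rnorm.
Qed.

Lemma contraction_adj a : M a -> contraction a -> contraction a^!.
Proof.
move=> Ma ca h; rewrite ler_rnorm.
have : ipR (a^! h) (a^! h) <= rnorm (a^! h) * rnorm h.
  rewrite -(ipR_adj hM Ma); apply: le_trans (ler_norm _) _.
  apply: le_trans (ipR_CS hH _ _) _.
  by rewrite ler_wpM2r ?rnorm_ge0 // -ler_rnorm.
rewrite (ipRE hH) expr2.
have [->|n0] := eqVneq (rnorm (a^! h)) 0; first by rewrite rnorm_ge0.
by rewrite ler_pM2l // lt_neqAle eq_sym n0 rnorm_ge0.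
Qed.

(** Multiplying [b] by [x] on the right amounts to replacing the test sequence [xi] by [x \o xi],
    which is again square summable. *)
Lemma predual_lmul x phi : M x -> contraction x -> predual ip M phi ->
  predual ip M (lmul x phi) /\ norm (lmul x phi) <= norm phi.
Proof.
move=> Mx cx p.
have bd y : M y -> contraction y -> rnorm (lmul x phi y : R[i]^o) <= norm phi.
  by move=> My cy; apply: (le_fnorm p); [apply: (vn_comp hM)|apply: contraction_comp].
split; last exact: fnorm_le.
apply: (predual_intro _ bd) => [c y z My Mz|a Ma].
  have -> : lmul x phi (c *: y + z) = phi (c *: (y \o x) + (z \o x)) by [].
  by rewrite (predual_linear p) //; apply: (vn_comp hM).
apply: (@predual_cvg phi ((fun b => b \o x) @ within M (nbhs (a : sigma_weak ip)))) => //.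
- by apply: filterS (withinT M _) => b Mb; apply: (vn_comp hM).
- exact: (vn_comp hM).
apply/sigma_weak_cvgP => -[[xi eta] [/= sx se]].
have sx' := square_summable_contraction cx sx.
have /sigma_weak_cvgP /(_ (exist _ (x \o xi, eta) (conj sx' se))) :
  within M (nbhs (a : sigma_weak ip)) --> (a : sigma_weak ip).
  exact: cvg_within.
by [].
Qed.

(** Here the factor passes to the other test sequence: [eta] becomes [x^! \o eta]. *)
Lemma predual_rmul x phi : M x -> contraction x -> predual ip M phi ->
  predual ip M (rmul phi x) /\ norm (rmul phi x) <= norm phi.
Proof.
move=> Mx cx p.
have bd y : M y -> contraction y -> rnorm (rmul phi x y : R[i]^o) <= norm phi.
  by move=> My cy; apply: (le_fnorm p); [apply: (vn_comp hM)|apply: contraction_comp].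
split; last exact: fnorm_le.
apply: (predual_intro _ bd) => [c y z My Mz|a Ma].
  rewrite [rmul _ _ _](_ : _ = phi (c *: (x \o y) + (x \o z))).
    by rewrite (predual_linear p) //; apply: (vn_comp hM).
  by congr phi; apply/funext => h; rewrite /= (vn_linear hM Mx).
apply: (@predual_cvg phi ((fun b => x \o b) @ within M (nbhs (a : sigma_weak ip)))) => //.
- by apply: filterS (withinT M _) => b Mb; apply: (vn_comp hM).
- exact: (vn_comp hM).
apply/sigma_weak_cvgP => -[[xi eta] [/= sx se]].
have se' := square_summable_contraction (contraction_adj Mx cx) se.
have /sigma_weak_cvgP /(_ (exist _ (xi, x^! \o eta) (conj sx se'))) :
  within M (nbhs (a : sigma_weak ip)) --> (a : sigma_weak ip).
  exact: cvg_within.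
have ee b : sigma_weak_eval ip (x \o b)
    (exist (fun p => square_summable p.1 /\ square_summable p.2) (xi, eta) (conj sx se)) =
  sigma_weak_eval ip b (exist (fun p => square_summable p.1 /\ square_summable p.2)
    (xi, x^! \o eta) (conj sx se')).
  rewrite /sigma_weak_eval /=; congr (limn (series _)); apply/funext => n.
  exact: (vn_adjoint hM Mx).
by rewrite ee; under eq_fun do rewrite -ee.
Qed.

Lemma ultra_predual_limit (U : set_system (H -> H)) : UltraFilter U ->
  U (M `&` [set a | contraction a]) ->
  exists a, [/\ M a, contraction a,
    forall h k, ipR (b h) k @[b --> U] --> ipR (a h) k &
    forall phi, predual ip M phi -> (phi b : R[i]^o) @[b --> U] --> (phi a : R[i]^o)].
Proof.
move=> UU UM; have PU : ProperFilter U by exact: ultra_proper.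
have [a [Ma ca wa]] := ultra_weak_limit hH hM UU UM.
exists a; split => // phi p; apply: predual_cvg => //.
  by apply: filterS UM => b [].
apply: weak_sigma_weak => //; by apply: filterS UM => b [].
Qed.

Lemma fnorm_attained phi : predual ip M phi ->
  exists x, [/\ M x, contraction x & phi x = (norm phi)%:C].
Proof.
move=> p; set N := norm phi.
(* The sets of almost norming contractions generate a proper filter; a limit along a finer
   ultrafilter is norming. *)
pose A (e : R) := [set b | M b /\ contraction b /\ N - e < rnorm (phi b : R[i]^o)].
pose F := filter_from [set e : R | 0 < e] A.
have PF : ProperFilter F.
  apply: filter_from_proper; last first.
    move=> e /= e0; have : N - e < N by rewrite gtrBl.
    move/(sup_gt (ball_values_nonempty phi)) => [_ [b [Mb cb] <-] lt].
    by exists b.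
  apply: filter_from_filter; first by exists 1 => /=.
  move=> e e' /= e0 e'0; exists (Num.min e e'); first by rewrite /= lt_min e0.
  move=> b [Mb [cb lb]]; split; split => //; split => //; apply: le_lt_trans lb.
    by rewrite lerB // ge_min lexx.
  by rewrite lerB // ge_min lexx orbT.
have [U [UU FU]] := ultraFilterLemma PF.
have PU : ProperFilter U by exact: ultra_proper.
have [|a [Ma ca _ /(_ _ p) cvg_a]] := @ultra_predual_limit U UU.
  by apply: FU; exists 1 => //= b [? []].
have na : rnorm (phi a : R[i]^o) = N.
  apply/eqP; rewrite eq_le le_fnorm //=; apply/ler_addgt0Pr => e e0.
  have e20 : 0 < e / 2 by rewrite divr_gt0.
  have e2C : 0 < (e / 2)%:C by rewrite ltcR.
  have U1 : U (A (e / 2)) by apply: FU; exists (e / 2).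
  have U2 : U [set b | `|(phi a : R[i]^o) - phi b| < (e / 2)%:C].
    by move/cvgrPdist_lt : cvg_a; apply.
  have [b [[Mb [cb lb]]]] := @filter_ex _ _ PU _ (filterI U1 U2).
  rewrite /= rnormC ltcR => lt.
  have := @rnormD R R[i]^o (phi a) (phi b - phi a).
  rewrite addrCA subrr addr0 -[phi b - phi a]opprB rnormN; lra.
have [N0|N0] := eqVneq N 0.
  exists 0; split; [exact: (vn_0 hM)|exact: contraction0|].
  by rewrite (linear_on0 (predual_linear p)) N0.
have Np : 0 < N by rewrite lt_neqAle eq_sym N0 fnorm_ge0.
(* The limit only satisfies |phi a| = N; this factor of modulus 1 rotates the value to N. The
   division explains the separate case N = 0. *)
pose c := (phi a)^*%C * (N^-1)%:C.
have nc : rnorm (c : R[i]^o) = 1.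
  rewrite rnormM [rnorm (N^-1%:C : R[i]^o)]rnormE /= expr0n addr0 sqrtr_sqr.
  rewrite ger0_norm ?invr_ge0 ?ltW //.
  have -> : rnorm ((phi a)^*%C : R[i]^o) = N.
    by rewrite -na !rnormE; case: (phi a) => u v /=; rewrite sqrrN.
  by rewrite divff.
exists (c *: a); split; first exact: (vn_scale hM).
  by move=> h; rewrite ler_rnorm [(c *: a) h]/(c *: a h) rnormZ nc mul1r -ler_rnorm.
rewrite (linear_onZ (predual_linear p)) // /c mulrAC [_^*%C * _]mulrC.
have -> : phi a * (phi a)^*%C = (N ^+ 2)%:C.
  rewrite -na sqr_rnorm; case: (phi a) => u v; apply: complexP => /=; ring.
by rewrite -rmorphM expr2 mulfK.
Qed.
End Predual.

(** * Positive functionals and their supports *)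

Section PositiveFunctional.
Context (R : realType) (H : completeNormedModType R[i]).
Context (ip : {dot H for @Num.conj R[i]}) (hH : hilbert_norm ip).
Context (M : set (H -> H)) (hM : von_neumann_algebra ip M).
Local Notation ipR := (ipR ip).
Local Notation "a ^!" := (adj ip a).
Local Notation norm := (fnorm M).
Implicit Types (a b x y : H -> H) (omega phi psi : (H -> H) -> R[i]).

Lemma posop_sqr a : M a -> posop ip (a^! \o a).
Proof.
move=> Ma; split=> [h k|h] /=.
  by rewrite -(ipR_adjr hM Ma) -(ipR_adj hM Ma).
by rewrite -(ipR_adjr hM Ma) (ipR_ge0 hH).
Qed.

Lemma posop_adj a : M a -> posop ip a -> a^! = a.
Proof. by move=> Ma [sa _]; apply: (adj_eq hM). Qed.

Lemma posop_scale (t : R) a : 0 <= t -> posop ip a -> posop ip (t%:C *: a).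
Proof.
move=> t0 [sa pa]; split=> [h k|h].
  by rewrite !fctE /= ipRZl ipRZr sa.
by rewrite !fctE /= ipRZl mulr_ge0.
Qed.

Lemma posop_unitop a : M a -> posop ip a ->
  exists t : R, 0 < t /\ unitop ip (t%:C *: a).
Proof.
move=> Ma pa; have /bounded_operatorP[_ [C [C0 aC]]] := vn_bounded hM Ma.
have C1 : 0 < C + 1 by apply: ltr_wpDl.
exists (C + 1)^-1; split; first by rewrite invr_gt0.
split=> [|h]; first by apply: posop_scale => //; rewrite invr_ge0 ltW.
rewrite !fctE /= ipRZl mulrC ler_pdivrMr //.
have := le_trans (ler_norm _) (ipR_CS hH (a h) h); have := aC h.
rewrite (ipRE hH h); have := rnorm_ge0 h; nra.
Qed.

Lemma posop_i a h : linear a -> posop ip a -> ipR (a h) ('i%C *: h) = 0.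
Proof.
move=> l /(op_le0P ip l) /(_ h).
rewrite [ip (0 h) h](_ : _ = 0); last by rewrite /= linear0l.
by rewrite ger0cE ipE /= => /andP[/eqP].
Qed.

(* Since [1 - c a] is a contraction for [0 <= a <= 1] and [|c - 1| <= 1], the
   number [N - c * omega a] has modulus at most [N] for all such [c]. *)
Lemma positive_of_norm omega (N : R) : linear_on M omega ->
  (forall x, M x -> contraction x -> rnorm (omega x : R[i]^o) <= N) ->
  omega idfun = N%:C -> positive_functional ip M omega.
Proof.
move=> l ub o1.
suff uni a : M a -> unitop ip a -> 0 <= omega a.
  move=> a Ma /(op_le0P ip (vn_linear hM Ma)) pa.
  have [t [t0 ut]] := posop_unitop Ma pa.
  have := uni _ (vn_scale hM t%:C Ma) ut.
  rewrite (linear_onZ hM l) // !ger0cE; case: (omega a) => u v /=.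
  by rewrite !mul0r addr0 subr0 pmulr_rge0 // mulf_eq0 gt_eqF.
move=> Ma ua; have la := vn_linear hM Ma.
have key (c : R) : 0 <= complex.Re (omega a) - c * complex.Im (omega a).
  (* L = (1 + i c) / (1 + c^2) satisfies |L|^2 = Re L = t, so |h - L a h|^2 = |h|^2 - 2 t (a h, h) +
     t |a h|^2 <= |h|^2. The real part of L omega(a) is t times the quantity in [key]. *)
  pose t := (1 + c ^+ 2)^-1; pose L := t +i* (t * c).
  have q0 : 0 < 1 + c ^+ 2 by apply: ltr_pwDl => //; apply: sqr_ge0.
  have t0 : 0 < t by rewrite invr_gt0.
  have tc : t ^+ 2 * (1 + c ^+ 2) = t by rewrite /t; field; rewrite gt_eqF.
  have Mx : M (idfun - L *: a).
    by apply: (vn_sub hM); [apply: (vn_id hM) | apply: (vn_scale hM)].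
  have cx : contraction (idfun - L *: a).
    apply/(contractionE hH) => h.
    have LE : (idfun - L *: a) h = h - (t%:C *: a h + (t * c)%:C *: ('i%C *: a h)).
      rewrite !fctE /=; congr (_ - _); rewrite scalerA -scalerDl.
      by congr (_ *: _); apply: complexP => /=; ring.
    rewrite LE !(ipRDl, ipRDr, ipRNl, ipRNr, ipRZl, ipRZr).
    have e1 : ipR ('i%C *: a h) h = 0.
      by rewrite ipR_conj conj_i scaleNr ipRNr posop_i ?oppr0 //; case: ua.
    have e2 : ipR (a h) ('i%C *: a h) = 0.
      have := posop_i (a := idfun) (a h); rewrite /=; apply => //.
      by split => // k; apply: ipR_ge0.
    have e3 : ipR ('i%C *: a h) ('i%C *: a h) = ipR (a h) (a h).
      by rewrite ipR_conj scalerA conj_i mulNr -expr2 sqr_i opprK scale1r.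
    rewrite (ipRC ip ('i%C *: a h) (a h)) e2 e3 (ipRC ip h ('i%C *: _)) e1.
    rewrite (ipRC ip h (a h)).
    have := unitop_sqr hH la ua h; have := ipR_ge0 hH (a h).
    set p := ipR (a h) (a h); set q := ipR (a h) h => p0 pq.
    have : t * p <= t * q by rewrite ler_pM2l.
    have : t * p = t ^+ 2 * p + (t * c) ^+ 2 * p by rewrite -{1}tc; ring.
    have : 0 <= t * q := mulr_ge0 (ltW t0) (le_trans p0 pq).
    rewrite !expr2; lra.
  have := le_trans (ler_norm _) (le_trans (Re_le_rnorm _) (ub _ Mx cx)).
  rewrite (linear_onB hM l) ?o1; [|exact: (vn_id hM)|exact: (vn_scale hM)].
  rewrite (linear_onZ hM l) //; case: (omega a) => u v /=.
  rewrite -(pmulr_rge0 _ t0); lra.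
rewrite ger0cE; have x0 := key 0; rewrite mul0r subr0 in x0.
rewrite x0 andbT; apply/negPn/negP => y0.
(* This slope would make the expression in [key] equal to - 1. *)
have := key ((complex.Re (omega a) + 1) / complex.Im (omega a)).
by rewrite divfK //; lra.
Qed.

Section Fixed.
Context (omega : (H -> H) -> R[i]).
Hypotheses (pw : predual ip M omega) (w0 : positive_functional ip M omega).
Let l : linear_on M omega := predual_linear pw.

Lemma pos_ge0 a : M a -> posop ip a -> 0 <= omega a.
Proof. by move=> Ma /(op_le0P ip (vn_linear hM Ma)); apply: w0. Qed.

Lemma pos_Im a : M a -> posop ip a -> complex.Im (omega a) = 0.
Proof. by move=> Ma pa; apply/eqP; have := pos_ge0 Ma pa; rewrite ger0cE => /andP[]. Qed.
Lemma pos_Re a : M a -> posop ip a -> 0 <= complex.Re (omega a).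
Proof. by move=> Ma pa; have := pos_ge0 Ma pa; rewrite ger0cE => /andP[]. Qed.

Lemma pos_form (c : R[i]) a b : M a -> M b ->
  omega ((a + c *: b)^! \o (a + c *: b)) =
    omega (a^! \o a) + c * omega (a^! \o b) + c^*%C * omega (b^! \o a) +
    c * c^*%C * omega (b^! \o b).
Proof.
move=> Ma Mb; have Mcb := vn_scale hM c Mb.
have Ma' := vn_adj hM Ma; have Mb' := vn_adj hM Mb.
rewrite (adj_add hM) // (adj_scale hM) //.
have -> : (a^! + c^*%C *: b^!) \o (a + c *: b) =
  c *: (a^! \o b) + (c^*%C *: (b^! \o a) + ((c * c^*%C) *: (b^! \o b) + (a^! \o a))).
  apply/funext => h; rewrite !fctE /= !(linopD (vn_linear hM Ma')) !(linopD (vn_linear hM Mb')).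
  rewrite !(linopZ (vn_linear hM Ma')) !(linopZ (vn_linear hM Mb')).
  by rewrite scalerDr !scalerA (mulrC c^*%C) -addrA addrC -!addrA.
have [M1 M2 M3 M4] : [/\ M (a^! \o b), M (b^! \o a), M (b^! \o b) & M (a^! \o a)].
  by split; apply: (vn_comp hM).
rewrite !l //; first by ring.
- exact: (vn_lin hM).
- by apply: (vn_lin hM) => //; apply: (vn_lin hM).
Qed.

(** Polarization: the form is real at a + b and at a + i b, which settles the imaginary and the real
    part respectively. *)
Lemma pos_herm a b : M a -> M b -> omega (b^! \o a) = (omega (a^! \o b))^*%C.
Proof.
move=> Ma Mb; have Maa := vn_comp hM (vn_adj hM Ma) Ma.
have Mbb := vn_comp hM (vn_adj hM Mb) Mb.
have r c : complex.Im (omega ((a + c *: b)^! \o (a + c *: b))) = 0.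
  have Mc : M (a + c *: b) by apply: (vn_add hM) => //; apply: (vn_scale hM).
  by apply: pos_Im (posop_sqr Mc); apply: (vn_comp hM) => //; apply: (vn_adj hM).
have ra := pos_Im Maa (posop_sqr Ma).
have rb := pos_Im Mbb (posop_sqr Mb).
have := r 1; have := r 'i%C; rewrite !pos_form //.
move: ra rb; case: (omega (a^! \o a)) => a1 a2; case: (omega (b^! \o b)) => b1 b2 /= -> ->.
case: (omega (a^! \o b)) => u v; case: (omega (b^! \o a)) => u' v' /= e1 e2.
apply: complexP => /=; lra.
Qed.

Lemma pos_adj a : M a -> omega (a^!) = (omega a)^*%C.
Proof.
by move=> Ma; have := pos_herm (vn_id hM) Ma; rewrite (adj_id hM).
Qed.

Lemma pos_CS a b : M a -> M b ->
  rnorm (omega (a^! \o b) : R[i]^o) ^+ 2 <=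
  complex.Re (omega (a^! \o a)) * complex.Re (omega (b^! \o b)).
Proof.
move=> Ma Mb; have Maa := vn_comp hM (vn_adj hM Ma) Ma.
have Mbb := vn_comp hM (vn_adj hM Mb) Mb.
have a0 := pos_Re Maa (posop_sqr Ma).
have b0 := pos_Re Mbb (posop_sqr Mb).
have rb := pos_Im Mbb (posop_sqr Mb).
set A := complex.Re _ in a0 *; set B := complex.Re _ in b0 *.
set z := omega (a^! \o b); set n := rnorm _.
have nE : n ^+ 2 = complex.Re z ^+ 2 + complex.Im z ^+ 2 by rewrite sqr_rnorm.
have [->|n0] := eqVneq n 0; first by rewrite expr0n mulr_ge0.
have np : 0 < n ^+ 2 by rewrite lt_neqAle eq_sym sqrf_eq0 n0 sqr_ge0.
have : (n ^+ 2) ^+ 2 <= A * (n ^+ 2 * B).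
  apply: quad_discr => [|t]; first by rewrite mulr_ge0 // sqr_ge0.
  (* This phase turns the cross terms into 2 t n^2, leaving a real quadratic polynomial in t with
     leading coefficient n^2 B. *)
  pose c := t%:C * z^*%C.
  have Mc : M (a + c *: b) by apply: (vn_add hM) => //; apply: (vn_scale hM).
  have := pos_Re (vn_comp hM (vn_adj hM Mc) Mc) (posop_sqr Mc).
  rewrite pos_form // (pos_herm Ma Mb) -/z nE.
  move: rb; rewrite /A /B /c; case: (z) => u v.
  case: (omega (a^! \o a)) => a1 a2; case: (omega (b^! \o b)) => b1 b2 /= -> q.
  by apply: le_trans q _; rewrite le_eqVlt; apply/orP; left; apply/eqP; ring.
by rewrite mulrCA {1}expr2 ler_pM2l.
Qed.

Lemma pos_null a : M a -> omega (a^! \o a) = 0 ->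
  forall y, M y -> omega (y \o a) = 0 /\ omega (a^! \o y) = 0.
Proof.
move=> Ma a0 y My; have My' := vn_adj hM My.
have e : omega (a^! \o y) = 0.
  have := pos_CS Ma My; rewrite a0 mul0r sqr_rnorm.
  case: (omega _) => u v /= q; have := sqr_ge0 u; have := sqr_ge0 v => ? ?.
  by apply: complexP => /=; apply/eqP; rewrite -sqrf_eq0; apply/eqP; lra.
split => //; have := pos_CS My' Ma; rewrite a0 mulr0 sqr_rnorm (vn_adjK hM My).
case: (omega _) => u v /= q; have := sqr_ge0 u; have := sqr_ge0 v => ? ?.
by apply: complexP => /=; apply/eqP; rewrite -sqrf_eq0; apply/eqP; lra.
Qed.

Lemma pos_mono a b : M a -> M b -> posop ip (b - a) ->
  complex.Re (omega a) <= complex.Re (omega b).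
Proof.
move=> Ma Mb p; have := pos_Re (vn_sub hM Mb Ma) p.
by rewrite (linear_onB hM l) // raddfB subr_ge0.
Qed.

Lemma contraction_posop a : M a -> contraction a -> posop ip (idfun - (a^! \o a)).
Proof.
move=> Ma /(contractionE hH) ca; have [s p] := posop_sqr Ma; split=> [h k|h].
  by have := s h k; rewrite !fctE /= ipRBl ipRBr => ->.
by rewrite !fctE ipRBl subr_ge0 /= -(ipR_adjr hM Ma).
Qed.

(** Cauchy-Schwarz against the identity, with omega(x^! x) <= omega(1). *)
Lemma pos_norm_le x : M x -> contraction x ->
  rnorm (omega x : R[i]^o) <= complex.Re (omega idfun).
Proof.
move=> Mx cx; have M1 := vn_id hM.
have := pos_CS M1 Mx; rewrite (adj_id hM).
rewrite -[idfun \o x]/x -[idfun \o idfun]/idfun => q.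
have Mxx := vn_comp hM (vn_adj hM Mx) Mx.
have m := pos_mono Mxx M1 (contraction_posop Mx cx).
have p := pos_Re Mxx (posop_sqr Mx).
rewrite -ler_sqr ?nnegrE ?rnorm_ge0 //; last exact: le_trans m.
apply: le_trans q _; rewrite expr2; apply: ler_wpM2l => //; exact: le_trans m.
Qed.

Lemma pos_idE : omega idfun = (complex.Re (omega idfun))%:C.
Proof.
have M1 := vn_id hM; apply: complexP => //=; apply: pos_Im => //.
by split => // h; apply: ipR_ge0.
Qed.

(** Since a^2 <= a. This makes [pos_null] applicable to [a] itself, so that null elements of the
    unit interval vanish under omega next to any factor. *)
Lemma unitop_null a : M a -> unitop ip a -> omega a = 0 -> omega (a \o a) = 0.
Proof.
move=> Ma ua a0; have [[sa pa] _] := ua.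
have aa := posop_adj Ma ua.1; have Maa := vn_comp hM Ma Ma.
have p2 : posop ip (a \o a) by have := posop_sqr Ma; rewrite aa.
have pd : posop ip (a - (a \o a)).
  split=> [h k|h]; rewrite !fctE /=.
    by rewrite ipRBl ipRBr !sa.
  by rewrite ipRBl subr_ge0 sa; apply: (unitop_sqr hH (vn_linear hM Ma)).
have := pos_mono Maa Ma pd; rewrite a0 /= => q.
by apply: complexP => /=; [apply/eqP; rewrite eq_le q pos_Re | apply: pos_Im].
Qed.
End Fixed.
End PositiveFunctional.

Section Support.
Context (R : realType) (H : completeNormedModType R[i]).
Context (ip : {dot H for @Num.conj R[i]}) (hH : hilbert_norm ip).
Context (M : set (H -> H)) (hM : von_neumann_algebra ip M).
Local Notation ipR := (ipR ip).
Local Notation "a ^!" := (adj ip a).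
Implicit Types (a b x y : H -> H).

Lemma op_leP a b : linear a -> linear b -> posop ip (b - a) <-> op_le ip a b.
Proof.
move=> la lb.
have lba : linear (b - a).
  move=> c u v; rewrite !fctE la lb scalerBr opprD.
  by rewrite addrACA.
split=> [/(op_le0P ip lba) p h|p].
  have := p h; rewrite [ip (0 h) h](_ : _ = 0); last by rewrite /= linear0l.
  by rewrite fctE linearDl linearNl subr_ge0.
apply/(op_le0P ip lba) => h.
rewrite [ip (0 h) h](_ : _ = 0); last by rewrite /= linear0l.
by rewrite fctE linearDl linearNl subr_ge0; apply: p.
Qed.

Lemma posop_anti a : linear a -> posop ip a -> posop ip (- a) -> a = 0.
Proof.
move=> l pa [_ na]; apply/funext => h; apply: (posop_eq0 l pa).
apply/eqP; rewrite eq_le pa.2 andbT; have := na h.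
by rewrite fctE ipRNl oppr_ge0.
Qed.

Lemma is_projectionP p : M p ->
  is_projection ip p <-> (p \o p = p /\ forall h k, ipR (p h) k = ipR h (p k)).
Proof.
move=> Mp; split=> -[pp sp]; split => //; first exact: is_adjointE.
by apply: is_adjointP => //; apply: vn_linear hM _ Mp.
Qed.

Lemma projection_unitop p : M p -> is_projection ip p -> unitop ip p.
Proof.
move=> Mp /(is_projectionP Mp)[pp sp].
have e h : ipR (p h) h = ipR (p h) (p h).
  by rewrite -[in LHS]pp /= sp.
split; first by split => // h; rewrite e (ipR_ge0 hH).
move=> h; rewrite -subr_ge0; have := ipR_ge0 hH (h - p h).
rewrite ipRBl !ipRBr -e sp -sp; lra.
Qed.

Section Fixed.
Context (omega : (H -> H) -> R[i]).
Hypotheses (pw : predual ip M omega) (w0 : positive_functional ip M omega).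
Let l : linear_on M omega := predual_linear pw.

Definition null_unit a := [/\ M a, unitop ip a & omega a = 0].

(** The tails of the chain generate a filter, and a weak limit along a finer ultrafilter dominates
    every member. Nullity survives because omega is normal. The empty chain is bounded by 0. *)
Lemma null_unit_chain (A : set {a | null_unit a}) :
  total_on A (fun s t => forall h, ipR (sval s h) h <= ipR (sval t h) h) ->
  exists t : {a | null_unit a}, forall s, A s ->
    forall h, ipR (sval s h) h <= ipR (sval t h) h.
Proof.
move=> tot; have [[s0 As0]|A0] := pselect (A !=set0); last first.
  have n0 : null_unit 0.
    split; [exact: (vn_0 hM)| |exact: (linear_on0 hM l)].
    by split=> [|h]; [split=> [h k|h]|]; rewrite ?ipR0l ?ipR0r ?(ipR_ge0 hH).
  by exists (exist _ _ n0) => s As; case: A0; exists s.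
pose B (s : {a | null_unit a}) := [set b | exists t, [/\ A t, b = sval t &
  forall h, ipR (sval s h) h <= ipR (sval t h) h]].
pose F := filter_from A B.
have PF : ProperFilter F.
  apply: filter_from_proper; last by move=> s As; exists (sval s), s.
  apply: filter_from_filter; first by exists s0.
  move=> s t As At; have [st|ts] := tot s t As At.
    exists t => // b [r [Ar -> tr]]; split; exists r; split => // h.
    exact: le_trans (st h) (tr h).
  exists s => // b [r [Ar -> tr]]; split; exists r; split => // h.
  exact: le_trans (ts h) (tr h).
have [U [UU FU]] := ultraFilterLemma PF.
have PU : ProperFilter U by exact: ultra_proper.
have UB s : A s -> U (B s) by move=> As; apply: FU; exists s.
have UN : U [set b | null_unit b].
  by apply: filterS (UB _ As0) => b [t [_ -> _]]; exact: (svalP t).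
have [|a [Ma ca wa /(_ _ pw) oa]] := @ultra_predual_limit _ _ _ hH _ hM U UU.
  apply: filterS UN => b [Mb ub _]; split => //.
  exact: (unitop_contraction hH (vn_linear hM Mb)).
have na : null_unit a.
  split => //; last first.
    apply: (@cvg_unique _ (@norm_hausdorff _ R[i]^o) _ _ _ _ oa).
    apply: cvg_trans (@cvg_cst R[i]^o 0 _ U _).
    by apply: near_eq_cvg; apply: filterS UN => b [_ _ ->].
  split; first split.
  - move=> h k; apply: (cvg_unique (@Rhausdorff R) (wa h k)).
    rewrite ipRC; apply: cvg_trans (wa k h); apply: near_eq_cvg.
    by apply: filterS UN => b [_ [[sb _] _] _]; rewrite sb ipRC.
  - move=> h; apply: (cvg_ger (wa h h)).
    by apply: filterS UN => b [_ [[_ pb] _] _] /=.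
  - move=> h; apply: (cvg_ler (wa h h)).
    by apply: filterS UN => b [_ [_ pb] _] /=.
exists (exist _ _ na) => s As h /=.
apply: (cvg_ger (wa h h)).
by apply: filterS (UB s As) => b [t [_ -> ]]; apply.
Qed.

Lemma null_unit_max : exists a, null_unit a /\
  forall b, null_unit b -> (forall h, ipR (a h) h <= ipR (b h) h) -> b = a.
Proof.
pose r (s t : {a | null_unit a}) := `[< forall h, ipR (sval s h) h <= ipR (sval t h) h >].
have [||||a amax] := @Zorn {a | null_unit a} r.
- by move=> t; apply/asboolP.
- move=> s t u /asboolP h1 /asboolP h2; apply/asboolP => h.
  exact: le_trans (h1 h) (h2 h).
- move=> [s ns] [t nt] /asboolP /= h1 /asboolP /= h2; apply: eq_exist => /=.
  have [Ms [[ss _] _] _] := ns; have [Mt [[st _] _] _] := nt.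
  apply/eqP; rewrite -subr_eq0; apply/eqP; apply: posop_anti.
  + by apply: (vn_linear hM); apply: (vn_sub hM).
  + split=> [h k|h]; rewrite !fctE ipRBl; first by rewrite ipRBr ss st.
    by rewrite subr_ge0.
  + split=> [h k|h]; rewrite !fctE ipRNl ipRBl; first by rewrite ipRNr ipRBr ss st.
    by rewrite opprB subr_ge0.
- move=> A tot; have [s t As At|t ht] := @null_unit_chain A.
    by have [/asboolP|/asboolP] := tot s t As At; [left|right].
  by exists t => s As; apply/asboolP; apply: ht.
exists (sval a); split; first exact: (svalP a).
move=> b nb ab; have := amax (exist _ _ nb).
by move=> /(_ _)/(congr1 sval) /= -> //; apply/asboolP.
Qed.

(* The null projection is a maximal element [a] of the null part of the
   positive unit ball: maximality against [2a - a^2] makes [a] idempotent, and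
   maximality against [a + (1-a)t(1-a)] makes it dominate every null [t]. *)
Lemma null_projection_exists : exists p, [/\ M p, is_projection ip p, omega p = 0 &
  forall t, M t -> posop ip t -> omega t = 0 -> t \o (idfun - p) = 0].
Proof.
have [a [[Ma ua a0] amax]] := null_unit_max.
have la := vn_linear hM Ma; have [[sa pa] a1] := ua.
have aa0 := unitop_null hH hM pw w0 Ma ua a0.
have aadj : a^! = a := posop_adj hM Ma ua.1.
have Maa := vn_comp hM Ma Ma.
have aaE : a \o a = a.
  (* The left side is 1 - (1 - a)^2, hence at most 1; it lies above [a] because a^2 <= a, and it is
     null because a^2 is. *)
  have e : a + (a - (a \o a)) = a.
    apply: amax.
      split.
      - by apply: (vn_add hM) => //; apply: (vn_sub hM).
      - have E h : (a + (a - (a \o a))) h = a h + (a h - a (a h)) by [].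
        split; first split.
        + by move=> h k; rewrite !E !(ipRDl, ipRDr, ipRNl, ipRNr) !sa.
        + move=> h; rewrite E !(ipRDl, ipRNl).
          have := unitop_sqr hH la ua h; have := pa h; rewrite (sa (a h) h); lra.
        + move=> h; rewrite E !(ipRDl, ipRNl) (sa (a h) h) (ipRC ip (a h) h).
          have := ipR_ge0 hH (h - a h); rewrite !(ipRDl, ipRDr, ipRNl, ipRNr) (ipRC ip (a h) h).
          lra.
      - rewrite (linear_onD l) //; last exact: (vn_sub hM).
        by rewrite (linear_onB hM l) // a0 aa0 !add0r oppr0.
    move=> h; rewrite !fctE !(ipRDl, ipRNl) /= sa.
    have := unitop_sqr hH la ua h; rewrite (sa h h); have := pa h; rewrite (sa h h).
    rewrite (sa (a h) h); lra.
  move: e => /(congr1 (fun f => f - a)); rewrite addrC addKr subrr => /eqP.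
  by rewrite subr_eq0 => /eqP <-.
have null t : M t -> omega (t \o a) = 0 /\ omega (a \o t) = 0.
  have := pos_null hH hM pw w0 Ma; by rewrite aadj => /(_ aa0 t).
pose q : H -> H := idfun - a.
have Mq : M q by apply: (vn_sub hM) => //; apply: (vn_id hM).
exists a; split => //.
  by apply/(is_projectionP Ma).
move=> t Mt pt t0; have [c [c0 ut]] := posop_unitop hH hM Mt pt.
set T := c%:C *: t in ut.
have MT : M T by exact: (vn_scale hM).
have lT := vn_linear hM MT; have lt := vn_linear hM Mt.
have T0 : omega T = 0 by rewrite (linear_onZ hM l) // t0 mulr0.
have sq h k : ipR (q h) k = ipR h (q k).
  by rewrite /q !fctE ipRBl ipRBr sa.
have [[sT pT] T1] := ut.
have qq h : ipR (q h) (q h) = ipR h h - ipR (a h) h.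
  rewrite sq /q !fctE /= (linopB la) -[a (a h)]/((a \o a) h) aaE subrr subr0.
  by rewrite ipRBr (ipRC ip h (a h)).
(* Here q T q <= q^2 = 1 - a keeps the sum below 1, and expanding both factors [q] leaves only terms
   killed by omega. *)
have e : a + (q \o T \o q) = a.
  apply: amax; last first.
    move=> h; rewrite [(a + _) h]/(a h + q (T (q h))) ipRDl lerDl sq.
    exact: pT.
  split.
  - by apply: (vn_add hM) => //; do 2!apply: (vn_comp hM) => //.
  - have E h : (a + (q \o T \o q)) h = a h + q (T (q h)) by [].
    split; first split.
    + by move=> h k; rewrite !E ipRDl ipRDr sa !sq sT -sq.
    + by move=> h; rewrite E ipRDl sq addr_ge0.
    + by move=> h; rewrite E ipRDl sq; have := T1 (q h); rewrite qq; lra.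
  - rewrite (linear_onD l) //; last by do 2!apply: (vn_comp hM) => //.
    rewrite a0 add0r.
    have -> : q \o T \o q = q \o T - (q \o T \o a).
      apply/funext => h; transitivity (q (T (h - a h))); first by [].
      by rewrite (linopB lT) (linopB (vn_linear hM Mq)).
    have MqT : M (q \o T) by exact: (vn_comp hM).
    rewrite (linear_onB hM l) //; last exact: (vn_comp hM).
    rewrite (null _ MqT).1 subr0.
    have -> : q \o T = T - (a \o T) by [].
    rewrite (linear_onB hM l) //; last exact: (vn_comp hM).
    by rewrite T0 (null _ MT).2 subrr.
have z h : ipR (T (q h)) (q h) = 0.
  have : (a + (q \o T \o q)) h = a h by rewrite e.
  rewrite [(a + _) h]/(a h + q (T (q h))) => /(canRL (addKr _)).
  rewrite addNr => z; by rewrite -sq z ipR0l.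
apply/funext => h; have := posop_eq0 lT ut.1 (z h).
rewrite /T fctE => /eqP; rewrite scaler_eq0 => /orP[/eqP c00|/eqP //].
by move: c0; rewrite (complexI c00) ltxx.
Qed.

Lemma support_props : let s := supp ip M omega in
  [/\ M s, is_projection ip s,
      (forall y, M y -> omega (y \o s) = omega y),
      (forall y, M y -> omega (s \o y) = omega y) &
      forall t, M t -> omega (t^! \o t) = 0 -> t \o s = 0].
Proof.
have [p [Mp pp p0 pmax]] := null_projection_exists.
have up := projection_unitop Mp pp.
have lp := vn_linear hM Mp.
have gp : greatest_null_projection ip M omega p.
  split => // q Mq qq q0; apply/op_leP => //; first exact: (vn_linear hM).
  have uq := projection_unitop Mq qq.
  (* Maximality applied to the null operator [q] gives q = q p, whence (q h, h) = |q p h|^2 <= |p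
     h|^2 = (p h, h). *)
  have z h : q h = q (p h).
    have := congr1 (@^~ h) (pmax q Mq uq.1 q0).
    rewrite /= !fctE (linopB (vn_linear hM Mq)) => /eqP.
    by rewrite subr_eq0 => /eqP.
  have [qq2 sq] := (is_projectionP Mq).1 qq; have [pp2 sp] := (is_projectionP Mp).1 pp.
  split=> [h k|h]; rewrite !fctE ipRBl; first by rewrite ipRBr sp sq.
  rewrite subr_ge0 -[in leLHS]qq2 /= sq z.
  have /(contractionE hH) cq := unitop_contraction hH (vn_linear hM Mq) uq.
  have -> : ipR (p h) h = ipR (p h) (p h) by rewrite -[in LHS]pp2 /= sp.
  exact: cq.
have uniq p' : greatest_null_projection ip M omega p' -> p' = p.
  move=> [Mp' pp' p'0 p'max]; apply/eqP; rewrite -subr_eq0; apply/eqP.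
  have lp' := vn_linear hM Mp'.
  apply: posop_anti.
  - by apply: (vn_linear hM); apply: (vn_sub hM).
  - by apply/op_leP => //; apply: p'max.
  - by rewrite opprB; apply/op_leP => //; case: gp => _ _ _; apply.
have sE : supp ip M omega = idfun - p.
  rewrite /supp; congr (_ - _); apply: uniq.
  exact: (@xgetPex _ 0 _ (ex_intro _ p gp)).
rewrite sE /=; set s := idfun - p.
have Ms : M s by apply: (vn_sub hM) => //; apply: (vn_id hM).
have [pp2 sp] := (is_projectionP Mp).1 pp.
have padj : p^! = p := posop_adj hM Mp up.1.
have null t : M t -> omega (t \o p) = 0 /\ omega (p \o t) = 0.
  have := pos_null hH hM pw w0 Mp; by rewrite padj pp2 => /(_ p0 t).
split => //.
- apply/(is_projectionP Ms); split; last first.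
    by move=> h k; rewrite /s !fctE ipRBl ipRBr sp.
  apply/funext => h; rewrite /s /= !fctE (linopB lp).
  by rewrite -[p (p h)]/((p \o p) h) pp2 subrr subr0.
- move=> y My; have -> : y \o s = y - (y \o p).
    by apply/funext => h; rewrite /s /= !fctE (linopB (vn_linear hM My)).
  by rewrite (linear_onB hM l) ?(null _ My).1 ?subr0 //; apply: (vn_comp hM).
- move=> y My; have -> : s \o y = y - (p \o y) by [].
  by rewrite (linear_onB hM l) ?(null _ My).2 ?subr0 //; apply: (vn_comp hM).
- move=> t Mt t0.
  have Mtt := vn_comp hM (vn_adj hM Mt) Mt.
  have /(congr1 (fun f => f _)) z := pmax _ Mtt (posop_sqr hH hM Mt) t0.
  apply/funext => h; apply: (ipR_eq0 hH) => /=.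
  have := z h; rewrite /= => zh.
  by rewrite (ipR_adj hM Mt) zh ipR0r.
Qed.
End Fixed.
End Support.

(** * Polar decomposition *)

Section Polar.
Context (R : realType) (H : completeNormedModType R[i]).
Context (ip : {dot H for @Num.conj R[i]}) (hH : hilbert_norm ip).
Context (M : set (H -> H)) (hM : von_neumann_algebra ip M).
Local Notation ipR := (ipR ip).
Local Notation "a ^!" := (adj ip a).
Local Notation norm := (fnorm M).
Implicit Types (a b x y : H -> H) (phi psi omega : (H -> H) -> R[i]).

Lemma rnorm_real (t : R) : rnorm (t%:C : R[i]^o) = `|t|.
Proof. by rewrite rnormE /= expr0n addr0 sqrtr_sqr. Qed.

Lemma contraction_scale x (k : R) : 0 < k ->
  (forall h, rnorm (x h) <= k * rnorm h) -> contraction (k^-1%:C *: x).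
Proof.
move=> k0 xk h; have ki : 0 <= k^-1 by rewrite invr_ge0 ltW.
by rewrite ler_rnorm fctE rnormZ rnorm_real ger0_norm // ler_pdivrMl.
Qed.

Lemma vn_contraction_scale x : M x -> exists t : R, 0 < t /\ contraction (t%:C *: x).
Proof.
move=> Mx; have /bounded_operatorP[_ [C [C0 xC]]] := vn_bounded hM Mx.
have C1 : 0 < C + 1 by apply: ltr_wpDl.
exists (C + 1)^-1; split; first by rewrite invr_gt0.
apply: contraction_scale => // h; apply: le_trans (xC h) _.
by rewrite ler_wpM2r ?rnorm_ge0 // lerDl.
Qed.

Lemma le_fnorm_scale phi (k : R) x : predual ip M phi -> 0 < k -> M x ->
  (forall h, rnorm (x h) <= k * rnorm h) ->
  rnorm (phi x : R[i]^o) <= k * norm phi.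
Proof.
move=> p k0 Mx /(contraction_scale k0) ck.
have := le_fnorm p (vn_scale hM k^-1%:C Mx) ck.
have ki : 0 <= k^-1 by rewrite invr_ge0 ltW.
rewrite (linear_onZ hM (predual_linear p)) // rnormM rnorm_real ger0_norm //.
by rewrite ler_pdivrMl.
Qed.

Lemma linear_on_eq phi psi : linear_on M phi -> linear_on M psi ->
  (forall y, M y -> contraction y -> phi y = psi y) -> eq_on M phi psi.
Proof.
move=> lp lq e y My; have [t [t0 ct]] := vn_contraction_scale My.
have := e _ (vn_scale hM t%:C My) ct.
rewrite !(linear_onZ hM) //; apply: mulfI.
by apply/eqP => /complexI t00; rewrite t00 ltxx in t0.
Qed.

Lemma fnorm_eq0 phi : predual ip M phi -> norm phi = 0 -> eq_on M phi (fun=> 0).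
Proof.
move=> p n0; apply: linear_on_eq; first exact: (predual_linear p).
  by move=> c x y _ _; rewrite mulr0 addr0.
move=> y My cy; apply/eqP; rewrite -(@normr_eq0 _ R[i]^o) rnormC; apply/eqP; congr (_%:C).
by apply/eqP; rewrite eq_le rnorm_ge0 andbT -n0 (le_fnorm p).
Qed.

Lemma unitop_subsqr x : M x -> contraction x -> unitop ip (idfun - (x^! \o x)).
Proof.
move=> Mx cx; split; first exact: (contraction_posop hH hM).
move=> h; rewrite fctE ipRBl gerBl; exact: (posop_sqr hH hM Mx).2.
Qed.

(* If [z := phi (y (1 - x* x))] were nonzero, [x + c y (1 - x* x)] has norm at
   most [sqrt (1 + |c|^2)], while [phi] takes there the value [N + c z], which
   grows linearly in [c] for a suitable phase of [c]. *)
Lemma fnorm_attained_cut phi x : predual ip M phi -> 0 < norm phi ->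
  M x -> contraction x -> phi x = (norm phi)%:C ->
  forall y, M y -> phi (y \o (x^! \o x)) = phi y.
Proof.
move=> p N0 Mx cx px y0 My0; have l := predual_linear p; set N := norm phi in N0 px *.
set d := idfun - (x^! \o x).
have Mxx : M (x^! \o x) by apply: (vn_comp hM) => //; apply: (vn_adj hM).
have Md : M d by apply: (vn_sub hM) => //; apply: (vn_id hM).
have ud : unitop ip d by apply: unitop_subsqr.
have l2 : linear_on M (fun y => phi (y \o (x^! \o x))).
  move=> c a b Ma Mb.
  have -> : (c *: a + b) \o (x^! \o x) = c *: (a \o (x^! \o x)) + (b \o (x^! \o x)) by [].
  by rewrite l //; apply: (vn_comp hM).
apply: (linear_on_eq l2 l) => // {y0 My0} y My cy.
have Myx : M (y \o (x^! \o x)) by exact: (vn_comp hM).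
have Myd : M (y \o d) by exact: (vn_comp hM).
have yd : y \o d = y - (y \o (x^! \o x)).
  by apply/funext => h; rewrite /d /= !fctE (linopB (vn_linear hM My)).
suff z0 : phi (y \o d) = 0.
  apply/esym/eqP; rewrite -subr_eq0; apply/eqP.
  by rewrite -(linear_onB hM l) // -yd.
set z := phi (y \o d); pose n := rnorm (z : R[i]^o).
(* The phase makes c z = n^2 / N = t n positive, and the modulus t = n / N yields perfect squares
   below. *)
pose c : R[i] := (N^-1)%:C * z^*%C.
have Mw : M (x + c *: (y \o d)) by apply: (vn_add hM) => //; apply: (vn_scale hM).
have nc : rnorm (c : R[i]^o) = n / N.
  rewrite rnormM rnorm_real ger0_norm; last by rewrite invr_ge0 ltW.
  rewrite mulrC; congr (_ / _).
  by rewrite /n !rnormE; case: (z) => u v /=; rewrite sqrrN.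
have n0 : 0 <= n by apply: rnorm_ge0.
have [t [tE t0 tN]] : exists t, [/\ n / N = t, 0 <= t & t * N = n].
  by exists (n / N); rewrite divfK ?gt_eqF // divr_ge0 // ltW.
rewrite tE in nc.
have k0 : 0 < Num.sqrt (1 + t ^+ 2) by rewrite sqrtr_gt0 ltr_pwDl // sqr_ge0.
have wk : forall h, rnorm ((x + c *: (y \o d)) h) <= Num.sqrt (1 + t ^+ 2) * rnorm h.
  move=> h; have := rnormD (x h) (c *: y (d h)); rewrite rnormZ nc.
  have := cy (d h); rewrite ler_rnorm => /(ler_wpM2l t0) le1 le2.
  rewrite [(x + _) h]/(x h + c *: y (d h)); apply: le_trans le2 _.
  apply: le_trans (lerD (lexx _) le1) _.
  have A0 := rnorm_ge0 (x h); have B0 := rnorm_ge0 (d h); have C0 := rnorm_ge0 h.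
  rewrite -ler_sqr ?nnegrE ?addr_ge0 ?mulr_ge0 ?sqrtr_ge0 //.
  rewrite exprMn sqr_sqrtr ?addr_ge0 ?sqr_ge0 //.
  have := unitop_sqr hH (vn_linear hM Md) ud h.
  have -> : ipR (d h) h = ipR h h - ipR (x h) (x h).
    by rewrite (_ : d h = h - x^! (x h)) // ipRBl -(ipR_adjr hM Mx).
  rewrite !(ipRE hH).
  set A := rnorm (x h) in A0 *; set B := rnorm (d h) in B0 *; set C := rnorm h in C0 *.
  move=> AB; apply: (@le_trans _ _ ((1 + t ^+ 2) * (A ^+ 2 + B ^+ 2))).
    rewrite -subr_ge0.
    have -> : (1 + t ^+ 2) * (A ^+ 2 + B ^+ 2) - (A + t * B) ^+ 2 = (t * A - B) ^+ 2 by ring.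
    exact: sqr_ge0.
  by rewrite ler_wpM2l ?addr_ge0 ?sqr_ge0 //; lra.
have := le_fnorm_scale p k0 Mw wk.
rewrite (linear_onD l) //; last exact: (vn_scale hM).
rewrite (linear_onZ hM l) // -/z -/N px.
have -> : N%:C + c * z = (N + t * n)%:C.
  have nn : n ^+ 2 = complex.Re z ^+ 2 + complex.Im z ^+ 2 by rewrite sqr_rnorm.
  have -> : t * n = N^-1 * n ^+ 2 by rewrite -tE expr2 mulrA (mulrC N^-1).
  rewrite nn /c; case: (z) => u v; apply: complexP => /=; ring.
rewrite rnorm_real ger0_norm; last by rewrite addr_ge0 ?mulr_ge0 // ltW.
rewrite -ler_sqr ?nnegrE ?addr_ge0 ?mulr_ge0 ?sqrtr_ge0 ?(ltW N0) //.
rewrite exprMn sqr_sqrtr ?addr_ge0 ?sqr_ge0 //.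
have -> : (1 + t ^+ 2) * N ^+ 2 = N ^+ 2 + n ^+ 2 by rewrite -tN; ring.
have -> : (N + t * n) ^+ 2 = N ^+ 2 + 2 * n ^+ 2 + (t * n) ^+ 2.
  by rewrite -tN; ring.
have := sqr_ge0 (t * n); have := sqr_ge0 n => h1 h2 h3.
have n00 : n = 0 by apply/eqP; rewrite -sqrf_eq0; apply/eqP; lra.
by apply/eqP; rewrite -(@normr_eq0 _ R[i]^o) rnormC -/n n00.
Qed.

Lemma polar_decomposition_exists phi : predual ip M phi -> 0 < norm phi ->
  exists v omega, is_polar_decomposition ip M phi v omega.
Proof.
move=> p N0; have [x [Mx cx px]] := fnorm_attained hH hM p.
have cut := fnorm_attained_cut p N0 Mx cx px; have l := predual_linear p.
set omega := lmul x phi.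
have [pw nw] := predual_lmul hM Mx cx p : predual ip M omega /\ norm omega <= norm phi.
have w1 : omega idfun = (norm phi)%:C by [].
have w0 : positive_functional ip M omega.
  apply: (positive_of_norm hH hM (predual_linear pw) _ w1) => y My cy.
  exact: le_trans (le_fnorm pw My cy) nw.
have [Ms ps ws sw sz] := support_props hH hM pw w0.
set s := supp ip M omega in Ms ps ws sw sz.
have Mx' := vn_adj hM Mx.
have [ss sa] := (is_projectionP hM Ms).1 ps.
have sadj : s^! = s by apply: (adj_eq hM).
pose v := x^! \o s; have Mv : M v by exact: (vn_comp hM).
have vE : v^! = s \o x by rewrite (adj_comp hM) // sadj (vn_adjK hM).
(* By the cut identity at [x], omega(x x^!) = phi(x x^! x) = N, so [T] is null and T s = 0. This is
   exactly what gives v^! v = s x x^! s = s. *)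
pose T := idfun - (x \o x^!).
have Mxx : M (x \o x^!) by exact: (vn_comp hM).
have MT : M T by apply: (vn_sub hM) => //; apply: (vn_id hM).
have uT : unitop ip T.
  have := unitop_subsqr Mx' (contraction_adj hH hM Mx cx).
  by rewrite (vn_adjK hM).
have T0 : omega T = 0.
  rewrite (linear_onB hM (predual_linear pw)) //; last exact: (vn_id hM).
  rewrite w1 -px; have := cut x Mx; rewrite -[omega _]/(phi (x \o (x^! \o x))) => ->.
  by rewrite subrr.
have Ts : T \o s = 0.
  apply: sz => //; rewrite (posop_adj hM MT uT.1).
  exact: (unitop_null hH hM pw w0).
have vv : v^! \o v = s.
  apply/funext => h; rewrite vE /v /=.
  have Tsh : s h - x (x^! (s h)) = 0 := congr1 (@^~ h) Ts.
  move/eqP : Tsh; rewrite subr_eq0 => /eqP <-.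
  by rewrite -[s (s h)]/((s \o s) h) ss.
exists v, omega; split => //; first by rewrite /partial_isometry vv.
split => // y My; rewrite /lmul -(cut y My).
have := ws (y \o x^!) (vn_comp hM My Mx'); rewrite /omega /lmul.
by move=> e; rewrite -[RHS]/(phi (((y \o x^!) \o s) \o x)) e.
Qed.

Lemma polar_decompositionP phi : predual ip M phi -> 0 < norm phi ->
  is_polar_decomposition ip M phi (phase ip M phi) (absf ip M phi).
Proof.
move=> p N0; have [v [omega vw]] := polar_decomposition_exists p N0.
exact: (@xgetPex _ (0, 0) [set p | is_polar_decomposition ip M phi p.1 p.2]
  (ex_intro _ (v, omega) vw)).
Qed.
End Polar.

(** * The norm equation *)

(** Parallelogram identity: the two squared moduli add up to 2 r^2 + 2 |z|^2. *)
Lemma complex_strict_convexity (R : realType) (r : R) (z : R[i]) : 0 <= r ->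
  rnorm (r%:C + z : R[i]^o) <= r -> rnorm (r%:C - z : R[i]^o) <= r -> z = 0.
Proof.
move=> r0 h1 h2; have {}h1 := lerXn2r 2 (rnorm_ge0 _) r0 h1.
have {}h2 := lerXn2r 2 (rnorm_ge0 _) r0 h2.
move: h1 h2; rewrite !sqr_rnorm; case: z => c d /=; rewrite add0r sub0r sqrrN.
have c2 := sqr_ge0 c; have d2 := sqr_ge0 d => h1 h2.
have e : (r + c) ^+ 2 + (r - c) ^+ 2 = 2 * r ^+ 2 + 2 * c ^+ 2 by ring.
by apply: complexP => /=; apply/eqP; rewrite -sqrf_eq0; apply/eqP; lra.
Qed.

Section NormEquation.
Context (R : realType) (H : completeNormedModType R[i]).
Context (ip : {dot H for @Num.conj R[i]}) (hH : hilbert_norm ip).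
Context (M : set (H -> H)) (hM : von_neumann_algebra ip M).
Local Notation ipR := (ipR ip).
Local Notation "a ^!" := (adj ip a).
Local Notation norm := (fnorm M).
Implicit Types (a b x y : H -> H).

Lemma projection_contraction e : M e -> is_projection ip e -> contraction e.
Proof.
move=> Me pe; apply: (unitop_contraction hH (vn_linear hM Me)).
exact: (projection_unitop hH hM).
Qed.

Context (phi : (H -> H) -> R[i]).
Hypotheses (p : predual ip M phi) (N0 : 0 < norm phi).
Local Notation N := (norm phi).
Local Notation l := (predual_linear p).
Local Notation v := (phase ip M phi).
Local Notation u := (v^!).
Local Notation omega := (absf ip M phi).
Local Notation s := (supp ip M omega).

Local Notation polar := (polar_decompositionP hH hM p N0).
Lemma absf_predual : predual ip M omega. Proof. by case: polar. Qed.
Lemma absf_positive : positive_functional ip M omega. Proof. by case: polar. Qed.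
Local Notation lw := (predual_linear absf_predual).
Lemma vn_phase : M v. Proof. by case: polar. Qed.
Lemma vn_phase_adj : M u. Proof. exact: (vn_adj hM vn_phase). Qed.
Local Hint Resolve vn_phase vn_phase_adj : core.
Lemma phase_adjK : u \o v = s. Proof. by case: polar => _ _ _ _ []. Qed.
Lemma polarE y : M y -> phi y = omega (y \o v).
Proof. by move=> My; case: polar => _ _ _ _ [_ ->]. Qed.
Lemma vn_supp : M s.
Proof. by case: (support_props hH hM absf_predual absf_positive). Qed.
Local Hint Resolve vn_supp : core.
Lemma supp_projection : is_projection ip s.
Proof. by case: (support_props hH hM absf_predual absf_positive). Qed.
Lemma supp_idem : s \o s = s. Proof. by case: supp_projection. Qed.
Lemma supp_sym h k : ipR (s h) k = ipR h (s k).
Proof. exact: ((is_projectionP hM vn_supp).1 supp_projection).2. Qed.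
Lemma absf_suppr y : M y -> omega (y \o s) = omega y.
Proof. by case: (support_props hH hM absf_predual absf_positive) => _ _ + _ _; apply. Qed.
Lemma absf_suppl y : M y -> omega (s \o y) = omega y.
Proof. by case: (support_props hH hM absf_predual absf_positive) => _ _ _ + _; apply. Qed.
Lemma supp_null t : M t -> omega (t^! \o t) = 0 -> t \o s = 0.
Proof. by case: (support_props hH hM absf_predual absf_positive) => _ _ _ _; apply. Qed.

Lemma supp_contraction : contraction s.
Proof. exact: (projection_contraction vn_supp supp_projection). Qed.
Local Hint Resolve supp_contraction : core.

Lemma phase_contraction : contraction v.
Proof.
apply/(contractionE hH) => h; rewrite (ipR_adj hM vn_phase) -[adj ip v _]/((u \o v) h) phase_adjK.
by rewrite -supp_sym; case: (projection_unitop hH hM vn_supp supp_projection).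
Qed.
Lemma phase_adj_contraction : contraction u.
Proof. exact: (contraction_adj hH hM vn_phase phase_contraction). Qed.
Local Hint Resolve phase_contraction phase_adj_contraction : core.

(** One inequality comes from |phi(y)| = |omega(y v)| <= omega(1), the other from omega(1) =
    omega(s) = phi(u). *)
Lemma absf_id : omega idfun = N%:C.
Proof.
have M1 := vn_id hM; rewrite (pos_idE hH hM absf_positive); congr (_%:C); apply/eqP.
rewrite eq_le; apply/andP; split; last first.
  apply: (fnorm_le hM) => y My cy; rewrite polarE //.
  apply: (pos_norm_le hH hM absf_predual absf_positive); first exact: (vn_comp hM).
  exact: contraction_comp.
apply: le_trans (ler_norm _) _; apply: le_trans (Re_le_rnorm _) _.
have := le_fnorm p vn_phase_adj phase_adj_contraction; rewrite polarE // phase_adjK.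
by have := absf_suppl M1; rewrite -[s \o idfun]/s => ->.
Qed.

Lemma absf_polar y : M y -> phi (y \o u) = omega y.
Proof.
move=> My; rewrite polarE; last exact: (vn_comp hM).
by rewrite -[(y \o u) \o v]/(y \o (u \o v)) phase_adjK absf_suppr.
Qed.

Lemma phi_phase_adj : phi u = N%:C.
Proof. by have := absf_polar (vn_id hM); rewrite absf_id. Qed.

Lemma phi_suppl y : M y -> phi (s \o y) = phi y.
Proof.
move=> My; rewrite !polarE //; last exact: (vn_comp hM).
by rewrite -[(s \o y) \o v]/(s \o (y \o v)) absf_suppl //; apply: (vn_comp hM).
Qed.

Definition half_projection e :=
  [/\ M e, is_projection ip e, s \o e = e, e \o s = e &
      (forall y, M y -> omega (e \o y) = omega (y \o e)) /\ omega e = (N / 2)%:C].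

(** The centralizer tests only elements of the corner. Replacing [y] by s y s changes neither side,
    since [s] fixes [e] and is absorbed by omega, so the commutation extends to all of [M]. *)
Lemma centralizer_half e : centralizer ip M omega e -> is_projection ip e ->
  omega e = (N / 2)%:C -> half_projection e.
Proof.
move=> [[a Ma ae] ce] pe we.
have Me : M e by rewrite -ae; do 2!apply: (vn_comp hM) => //.
have se : s \o e = e
  by rewrite -ae; apply/funext => h /=; rewrite -[s (s _)]/((s \o s) _) supp_idem.
have es : e \o s = e
  by rewrite -ae; apply/funext => h /=; rewrite -[s (s h)]/((s \o s) _) supp_idem.
split => //; split => // y My.
have Msy : M (s \o y) by exact: (vn_comp hM).
have := ce (s \o y \o s)=> c.
have {}c : omega (e \o (s \o y \o s)) = omega ((s \o y \o s) \o e).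
  by apply: c; exists y.
have := c; rewrite -[e \o (s \o y \o s)]/((e \o s) \o y \o s) es.
rewrite absf_suppr; last exact: (vn_comp hM).
move=> ->; rewrite -[(s \o y \o s) \o e]/(s \o (y \o (s \o e))) se absf_suppl //.
exact: (vn_comp hM).
Qed.

(** Writing e = e^2 and commuting one factor to the right gives phi(e y) = omega(e z e) with z = y
    v. Cauchy-Schwarz then bounds its square by omega(e) omega((z e)^! (z e)) <= omega(e)^2. *)
Lemma half_bound e y : half_projection e -> M y -> contraction y ->
  rnorm (phi (e \o y) : R[i]^o) <= N / 2.
Proof.
move=> [Me pe se es [ce we]] My cy.
have [ee ea] := (is_projectionP hM Me).1 pe.
have eadj : e^! = e by apply: (adj_eq hM).
pose z := y \o v; have Mz : M z by exact: (vn_comp hM).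
have Mze : M (z \o e) by exact: (vn_comp hM).
rewrite polarE; last exact: (vn_comp hM).
have -> : omega ((e \o y) \o v) = omega (e^! \o (z \o e)).
  have Mez : M (e \o z) by exact: (vn_comp hM).
  rewrite eadj -[RHS]/(omega ((e \o z) \o e)) -ce //.
  by rewrite -[RHS]/(omega ((e \o e) \o z)) ee.
have := pos_CS hH hM absf_predual absf_positive Me Mze; rewrite eadj ee we /= => q.
have Mzz := vn_comp hM (vn_adj hM Mze) Mze.
have m : complex.Re (omega ((z \o e)^! \o (z \o e))) <= N / 2.
  have := pos_mono hM absf_predual absf_positive Mzz Me; rewrite we /=; apply.
  have [sz' _] := posop_sqr hH hM Mze; split=> [h k|h].
    by have := sz' h k; rewrite !fctE /= ipRBl ipRBr ea => ->.
  rewrite fctE ipRBl subr_ge0 /= -(ipR_adjr hM Mze) /=.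
  have /(contractionE hH) cz := contraction_comp cy phase_contraction.
  have -> : ipR (e h) h = ipR (e h) (e h) by rewrite -[in LHS]ee /= ea.
  exact: cz.
have N2 : 0 <= N / 2 by rewrite divr_ge0 // ltW.
rewrite -ler_sqr ?nnegrE ?rnorm_ge0 //; apply: le_trans q _.
by rewrite expr2 ler_wpM2l.
Qed.

Lemma half_value e : half_projection e -> phi (e \o u) = (N / 2)%:C.
Proof.
move=> [Me pe se es [ce we]]; rewrite polarE; last exact: (vn_comp hM).
by rewrite -[(e \o u) \o v]/(e \o (u \o v)) phase_adjK es.
Qed.

Lemma fnorm_eq_value psi y : predual ip M psi ->
  (forall x, M x -> contraction x -> rnorm (psi x : R[i]^o) <= N) ->
  M y -> contraction y -> psi y = N%:C -> norm psi = N.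
Proof.
move=> q ub My cy py; apply/eqP; rewrite eq_le (fnorm_le hM ub) /=.
by have := le_fnorm q My cy; rewrite py rnorm_real ger0_norm // ltW.
Qed.

Lemma half_fnorm e psi : half_projection e -> predual ip M psi ->
  (forall y, M y -> psi y = 2 * phi (e \o y)) -> norm psi = N.
Proof.
move=> he q psiE; have r2 : rnorm (2 : R[i]^o) = 2.
  by rewrite -(rmorph_nat (real_complex R)) rnorm_real ger0_norm.
apply: (fnorm_eq_value q) vn_phase_adj phase_adj_contraction _ => [y My cy|].
  rewrite psiE // rnormM r2 mulrC -ler_pdivlMr //; exact: half_bound.
rewrite psiE // (half_value he) -(rmorph_nat (real_complex R)) -rmorphM /=.
by rewrite mulrC divfK.
Qed.

Lemma splitting_solution ep em : centralizer_splitting ip M omega ep em ->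
  omega ep = (N / 2)%:C -> omega em = (N / 2)%:C ->
  let psi := rmul phi ep \- rmul phi em in
  [/\ predual ip M psi,
      [/\ norm (phi \+ psi) = N, norm (phi \- psi) = N & norm psi = N] &
      eq_on M (lmul (v \o (ep - em)) omega) psi].
Proof.
move=> [[cp pp] [cm pm] pm0 pmE] wp wm /=.
have hp := centralizer_half cp pp wp; have hm := centralizer_half cm pm wm.
have [Mp _ sp ps' [cep _]] := hp; have [Mm _ sm ms' [cem _]] := hm.
have [pp2 pa] := (is_projectionP hM Mp).1 pp.
have [mm2 ma] := (is_projectionP hM Mm).1 pm.
have ctp := projection_contraction Mp pp; have ctm := projection_contraction Mm pm.
have [q1 _] := predual_rmul hH hM Mp ctp p.
have [q2 _] := predual_rmul hH hM Mm ctm p.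
have q := predual_sub hM q1 q2.
have phi_sum y : M y -> phi y = phi (ep \o y) + phi (em \o y).
  move=> My; rewrite -phi_suppl // -pmE -[(ep + em) \o y]/((ep \o y) + (em \o y)).
  by rewrite (linear_onD l) //; apply: (vn_comp hM).
split => //; last first.
  move=> y My; rewrite /lmul /rmul /=.
  have Myv : M (y \o v) by exact: (vn_comp hM).
  have -> : y \o (v \o (ep - em)) = ((y \o v) \o ep) - ((y \o v) \o em).
    apply/funext => h; transitivity (y (v (ep h - em h))); first by [].
    by rewrite (linopB (vn_linear hM vn_phase)) (linopB (vn_linear hM My)).
  rewrite (linear_onB hM lw); [|exact: (vn_comp hM)|exact: (vn_comp hM)].
  rewrite -cep // -cem // (polarE (vn_comp hM Mp My)) (polarE (vn_comp hM Mm My)).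
  by [].
have q3 := predual_add hM p q; have q4 := predual_sub hM p q.
split.
- apply: (half_fnorm hp q3) => y My.
  by rewrite /= /rmul (phi_sum y My); ring.
- apply: (half_fnorm hm q4) => y My.
  by rewrite /= /rmul (phi_sum y My); ring.
(* Here psi = phi(D .) with [D] a symmetry of the support, D^2 = s. Its norm is attained at D u,
   where the value is phi(s u) = phi(u) = N. *)
- pose D := ep - em; have MD : M D by exact: (vn_sub hM).
  have mp0 : em \o ep = 0.
    apply/funext => h; apply: (ipR_eqP (ip := ip)) => k.
    by rewrite /= ma pa -[ep (em k)]/((ep \o em) k) pm0 ipR0r ipR0l.
  have DD : D \o D = s.
    apply/funext => h; rewrite -pmE [LHS]/(ep (ep h - em h) - em (ep h - em h)).
    rewrite (linopB (vn_linear hM Mp)) (linopB (vn_linear hM Mm)).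
    rewrite -[ep (ep h)]/((ep \o ep) h) -[ep (em h)]/((ep \o em) h).
    rewrite -[em (ep h)]/((em \o ep) h) -[em (em h)]/((em \o em) h).
    by rewrite pp2 pm0 mp0 mm2 subr0 sub0r opprK.
  have cD : contraction D.
    apply/(contractionE hH) => h.
    have -> : ipR (D h) (D h) = ipR h (D (D h)).
      by rewrite {1}/D !fctE ipRBl pa ma -ipRBr.
    rewrite -[D (D h)]/((D \o D) h) DD -supp_sym.
    by case: (projection_unitop hH hM vn_supp supp_projection).
  have [q5 n5] := predual_rmul hH hM MD cD p.
  have e5 : eq_on M (rmul phi D) (rmul phi ep \- rmul phi em).
    move=> y My; rewrite /rmul /= -(linear_onB hM l) //; exact: (vn_comp hM).
  apply: (fnorm_eq_value q (y := D \o u)).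
  + by move=> y My cy; rewrite -(e5 y My); apply: le_trans (le_fnorm q5 My cy) n5.
  + exact: (vn_comp hM).
  + exact: contraction_comp.
  + rewrite -(e5 _ (vn_comp hM MD vn_phase_adj)).
    by rewrite /rmul -[D \o (D \o u)]/((D \o D) \o u) DD phi_suppl // phi_phase_adj.
Qed.

(* With [wp y = (phi + psi)(y u)], [wm y = (phi - psi)(y u)] and
   [chi y = psi (y u)] the hypotheses make [wp] and [wm] positive of
   norm [N]. A self-adjoint contraction [a] with [chi a = N] then gives
   [ap = (1 + a) / 2], [am = (1 - a) / 2] with [wm ap = wp am = 0], and
   compressing [ap], [am] to the support turns them into the projections. *)
Lemma norm_equation_splitting psi : predual ip M psi ->
  norm (phi \+ psi) = N -> norm (phi \- psi) = N -> norm psi = N ->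
  exists ep em, [/\ centralizer_splitting ip M omega ep em,
    omega ep = (N / 2)%:C, omega em = (N / 2)%:C &
    eq_on M psi (rmul phi ep \- rmul phi em)].
Proof.
move=> q np nm nq; have M1 := vn_id hM; have lq := predual_linear q.
have qp := predual_add hM p q; have qm := predual_sub hM p q.
(* Both N + psi(u) and N - psi(u) lie in the disk of radius N. *)
have psi_u : psi u = 0.
  have := le_fnorm qp vn_phase_adj phase_adj_contraction.
  have := le_fnorm qm vn_phase_adj phase_adj_contraction.
  rewrite np nm /= phi_phase_adj.
  by move=> h1 h2; apply: (complex_strict_convexity (ltW N0) h2 h1).
pose wp := lmul u (phi \+ psi); pose wm := lmul u (phi \- psi).
pose chi := lmul u psi.
have [pwp nwp] : predual ip M wp /\ norm wp <= norm (phi \+ psi).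
  exact: (predual_lmul hM vn_phase_adj phase_adj_contraction qp).
have [pwm nwm] : predual ip M wm /\ norm wm <= norm (phi \- psi).
  exact: (predual_lmul hM vn_phase_adj phase_adj_contraction qm).
have [pchi nchi] : predual ip M chi /\ norm chi <= norm psi.
  exact: (predual_lmul hM vn_phase_adj phase_adj_contraction q).
have lchi := predual_linear pchi.
rewrite np in nwp; rewrite nm in nwm; rewrite nq in nchi.
have wp1 : wp idfun = N%:C by rewrite -[wp _]/(phi u + psi u) phi_phase_adj psi_u addr0.
have wm1 : wm idfun = N%:C by rewrite -[wm _]/(phi u - psi u) phi_phase_adj psi_u subr0.
have wp0 : positive_functional ip M wp.
  apply: (positive_of_norm hH hM (predual_linear pwp) _ wp1) => y My cy.
  exact: le_trans (le_fnorm pwp My cy) nwp.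
have wm0 : positive_functional ip M wm.
  apply: (positive_of_norm hH hM (predual_linear pwm) _ wm1) => y My cy.
  exact: le_trans (le_fnorm pwm My cy) nwm.
have wpE y : M y -> wp y = omega y + chi y.
  by move=> My; rewrite -(absf_polar My).
have wmE y : M y -> wm y = omega y - chi y.
  by move=> My; rewrite -(absf_polar My).
have uadj : u^! = v by exact: (vn_adjK hM vn_phase).
(* Both phi + psi and phi - psi attain their norm at [u], so neither changes when [y] becomes y v u;
   half the difference is the claim. *)
have psiE y : M y -> psi y = chi (y \o v).
  move=> My; have N0p : 0 < norm (phi \+ psi) by rewrite np.
  have N0m : 0 < norm (phi \- psi) by rewrite nm.
  have ep : (phi \+ psi) u = (norm (phi \+ psi))%:C by rewrite np.
  have em : (phi \- psi) u = (norm (phi \- psi))%:C by rewrite nm.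
  have := fnorm_attained_cut hH hM qp N0p vn_phase_adj phase_adj_contraction ep My.
  have := fnorm_attained_cut hH hM qm N0m vn_phase_adj phase_adj_contraction em My.
  rewrite uadj -[chi _]/(psi (y \o (v \o u))) /= => h1 h2.
  have h3 : 2 * psi (y \o (v \o u)) = 2 * psi y.
    have -> : 2 * psi y = (phi y + psi y) - (phi y - psi y) by ring.
    by rewrite -h1 -h2; ring.
  by apply/esym; apply: (mulfI _ h3); rewrite pnatr_eq0.
have chiN : norm chi = N.
  apply/eqP; rewrite eq_le nchi /= -nq; apply: (fnorm_le hM) => y My cy.
  rewrite psiE //; apply: (le_fnorm pchi); first exact: (vn_comp hM).
  exact: contraction_comp.
have chi1 : chi idfun = 0 by [].
have [x [Mx cx chix]] := fnorm_attained hH hM pchi.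
rewrite chiN in chix.
have Mx' := vn_adj hM Mx.
have two0 : (2 : R[i]) != 0 by rewrite pnatr_eq0.
(* As half the difference of two positive functionals, [chi] is hermitian, so [x] may be replaced by
   its self-adjoint part [a]. *)
have chix' : chi x^! = N%:C.
  have := pos_adj hH hM pwp wp0 Mx; have := pos_adj hH hM pwm wm0 Mx.
  rewrite !wpE ?wmE // chix => h1 h2.
  apply: (mulfI two0).
  have -> : 2 * chi x^! = (omega x^! + chi x^!) - (omega x^! - chi x^!) by ring.
  rewrite h1 h2; case: (omega x) => c d; apply: complexP => /=; ring.
pose a := 2^-1%:C *: (x + x^!).
have Ma : M a by apply: (vn_scale hM); apply: (vn_add hM).
have adjh h k : ipR (a h) k = ipR h (a k).
  rewrite /a !fctE ipRZl ipRZr ipRDl ipRDr (ipR_adj hM Mx) -(ipR_adjr hM Mx).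
  by rewrite addrC.
have ca h : `|ipR (a h) h| <= ipR h h.
  have := ipR_CS hH (x h) h; have := cx h; rewrite ler_rnorm => le1 le2.
  have -> : ipR (a h) h = ipR (x h) h.
    by rewrite /a !fctE ipRZl ipRDl -(ipR_adjr hM Mx) (ipRC ip h); field.
  apply: le_trans le2 _; rewrite (ipRE hH h) expr2.
  by rewrite ler_wpM2r ?rnorm_ge0.
have chia : chi a = N%:C.
  rewrite (linear_onZ hM lchi) ?(linear_onD lchi) ?chix ?chix' //.
    by apply: complexP => /=; field.
  exact: (vn_add hM).
pose ap := 2^-1%:C *: (idfun + a); pose am := 2^-1%:C *: (idfun - a).
have Map : M ap by apply: (vn_scale hM); apply: (vn_add hM).
have Mam : M am by apply: (vn_scale hM); apply: (vn_sub hM).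
have apE h : ap h = 2^-1%:C *: (h + a h) by [].
have amE h : am h = 2^-1%:C *: (h - a h) by [].
have upp : unitop ip ap.
  split; first split.
  - by move=> h k; rewrite !apE ipRZl ipRZr ipRDl ipRDr adjh.
  - by move=> h; rewrite apE ipRZl ipRDl; have := ca h; rewrite ler_norml => /andP[]; lra.
  - by move=> h; rewrite apE ipRZl ipRDl; have := ca h; rewrite ler_norml => /andP[]; lra.
have upm : unitop ip am.
  split; first split.
  - by move=> h k; rewrite !amE ipRZl ipRZr ipRBl ipRBr adjh.
  - by move=> h; rewrite amE ipRZl ipRBl; have := ca h; rewrite ler_norml => /andP[]; lra.
  - by move=> h; rewrite amE ipRZl ipRBl; have := ca h; rewrite ler_norml => /andP[]; lra.
have pm1 : am = idfun - ap.
  apply/funext => h; rewrite amE -[RHS]/(h - 2^-1%:C *: (h + a h)).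
  rewrite scalerBr scalerDr opprD addrA; congr (_ - _).
  rewrite -[X in _ = X - _]scale1r -scalerBl; congr (_ *: _).
  by apply: complexP => /=; field.
have chiap : chi ap = (N / 2)%:C.
  rewrite (linear_onZ hM lchi) ?(linear_onD lchi) ?chia ?chi1 //; last exact: (vn_add hM).
  by apply: complexP => /=; field.
have chiam : chi am = (- (N / 2))%:C.
  rewrite pm1 (linear_onB hM lchi) // chi1 chiap sub0r.
  by rewrite rmorphN.
have omsum : omega ap + omega am = N%:C.
  by rewrite pm1 (linear_onB hM lw) // addrC subrK absf_id.
(* Positivity of wm(ap) and wp(am) says that both values are at least N/2, while their sum is N. *)
have [omap omam] : omega ap = (N / 2)%:C /\ omega am = (N / 2)%:C.
  have i1 := pos_Im hM absf_positive Map upp.1; have i2 := pos_Im hM absf_positive Mam upm.1.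
  have := pos_Re hM wm0 Map upp.1; have := pos_Re hM wp0 Mam upm.1.
  rewrite wpE // wmE // chiap chiam.
  have := congr1 (@complex.Re _) omsum.
  move: i1 i2; case: (omega ap) => c1 d1; case: (omega am) => c2 d2 /= -> ->.
  by move=> h1 h2 h3; split; apply: complexP => //=; lra.
have wmap : wm ap = 0 by rewrite wmE // chiap omap subrr.
have wpam : wp am = 0 by rewrite wpE // chiam omam rmorphN subrr.
have apj := posop_adj hM Map upp.1; have amj := posop_adj hM Mam upm.1.
have nullm y : M y -> wm (y \o ap) = 0 /\ wm (ap \o y) = 0.
  have := pos_null hH hM pwm wm0 Map; rewrite apj; apply.
  exact: (unitop_null hH hM pwm wm0).
have nullp y : M y -> wp (y \o am) = 0 /\ wp (am \o y) = 0.
  have := pos_null hH hM pwp wp0 Mam; rewrite amj; apply.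
  exact: (unitop_null hH hM pwp wp0).
have am_r y : M y -> y \o am = y - (y \o ap).
  by move=> My; rewrite pm1 (linop_compB _ _ (vn_linear hM My)).
have am_l y : am \o y = y - (ap \o y) by rewrite pm1.
(* Nullity of wm at y ap gives omega(y ap) = chi(y ap); substituting this into wp(y am) = 0 gives
   the identity. [half_l] is the mirror image, and the common right side yields [comm]. *)
have half_r y : M y -> 2 * omega (y \o ap) = omega y + chi y.
  move=> My; have Myp : M (y \o ap) by exact: (vn_comp hM).
  have Mym : M (y \o am) by exact: (vn_comp hM).
  have := (nullm y My).1; have := (nullp y My).1.
  rewrite wpE // wmE // (am_r y) // (linear_onB hM lw) // (linear_onB hM lchi) //.
  move=> h1 /eqP; rewrite subr_eq0 => /eqP h2; rewrite h2 in h1 *.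
  by apply/eqP; rewrite eq_sym -subr_eq0 -h1; apply/eqP; ring.
have half_l y : M y -> 2 * omega (ap \o y) = omega y + chi y.
  move=> My; have Myp : M (ap \o y) by exact: (vn_comp hM).
  have Mym : M (am \o y) by exact: (vn_comp hM).
  have := (nullm y My).2; have := (nullp y My).2.
  rewrite wpE // wmE // (am_l y) // (linear_onB hM lw) // (linear_onB hM lchi) //.
  move=> h1 /eqP; rewrite subr_eq0 => /eqP h2; rewrite h2 in h1 *.
  by apply/eqP; rewrite eq_sym -subr_eq0 -h1; apply/eqP; ring.
have comm y : M y -> omega (ap \o y) = omega (y \o ap).
  by move=> My; apply: (mulfI two0); rewrite half_l ?half_r.
have Mpm : M (ap \o am) by exact: (vn_comp hM).
have Mmp : M (am \o ap) by exact: (vn_comp hM).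
(* By [half_r], 2 omega(ap am am ap) = wp(ap am am) = 0, so am ap vanishes on the support. *)
have app h : ap (ap (s h)) = ap (s h).
  have T0 : (am \o ap) \o s = 0.
    apply: supp_null => //; rewrite (adj_comp hM) // apj amj.
    rewrite -[(ap \o am) \o (am \o ap)]/(((ap \o am) \o am) \o ap).
    apply: (mulfI two0); rewrite half_r; last exact: (vn_comp hM).
    by rewrite mulr0 -wpE ?(nullp _ Mpm).1 //; exact: (vn_comp hM).
  have := congr1 (@^~ h) T0; rewrite pm1 -[LHS]/(ap (s h) - ap (ap (s h))).
  by move/eqP; rewrite subr_eq0 => /eqP.
have Mq : M (idfun - s) by apply: (vn_sub hM).
have qadj : (idfun - s)^! = idfun - s.
  by apply: (adj_eq hM) => // h k; rewrite !fctE ipRBl ipRBr supp_sym.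
(* Commuting the outer [ap] to the right leaves 1 - s in front, which omega annihilates; hence (1 -
   s) ap s = 0. *)
have aps h : s (ap (s h)) = ap (s h).
  have T0 : ((idfun - s) \o ap) \o s = 0.
    apply: supp_null; first exact: (vn_comp hM).
    rewrite (adj_comp hM) // apj qadj.
    pose Y := (idfun - s) \o ((idfun - s) \o ap).
    have MY : M Y by do 2!apply: (vn_comp hM) => //.
    rewrite -[X in omega X]/(ap \o Y) comm //.
    pose W := ((idfun - s) \o ap) \o ap.
    have MW : M W by do 2!apply: (vn_comp hM) => //.
    rewrite -[Y \o ap]/(W - (s \o W)) (linear_onB hM lw) ?absf_suppl ?subrr //.
    exact: (vn_comp hM).
  have := congr1 (@^~ h) T0; rewrite -[LHS]/(ap (s h) - s (ap (s h))).
  by move/eqP; rewrite subr_eq0 => /eqP.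
have apa : forall h k, ipR (ap h) k = ipR h (ap k) by case: upp => -[].
(* A symmetric operator leaving the range of a projection invariant commutes with the projection. *)
have sap h : s (ap h) = ap (s h).
  apply: (ipR_eqP (ip := ip)) => k.
  by rewrite supp_sym apa -[in LHS]aps -supp_sym -apa -supp_sym aps.
have amsE h : am (s h) = s h - ap (s h) by rewrite pm1.
have idem h : s (s h) = s h by rewrite -[s (s h)]/((s \o s) h) supp_idem.
have samsE h : s (s h - ap (s h)) = s h - ap (s h).
  by rewrite (linopB (vn_linear hM vn_supp) (s h)) (idem h) (aps h).
have Mep : M (ap \o s) by exact: (vn_comp hM).
have Mem : M (am \o s) by exact: (vn_comp hM).
have cent_p y : M y -> omega ((ap \o s) \o y) = omega (y \o ap).
  move=> My; rewrite -[(ap \o s) \o y]/(ap \o (s \o y)) comm; last exact: (vn_comp hM).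
  by rewrite -[(s \o y) \o ap]/(s \o (y \o ap)) absf_suppl //; apply: (vn_comp hM).
have emE : am \o s = s - (ap \o s) by apply/funext => h; rewrite /= amsE.
have cent_m y : M y -> omega ((am \o s) \o y) = omega (y \o am).
  move=> My; have Msy : M (s \o y) by exact: (vn_comp hM).
  rewrite emE -[(s - _) \o y]/((s \o y) - ((ap \o s) \o y)) am_r //.
  rewrite (linear_onB hM lw Msy (vn_comp hM Mep My)) absf_suppl // cent_p //.
  by rewrite (linear_onB hM lw My (vn_comp hM My Map)).
have pep : is_projection ip (ap \o s).
  apply/(is_projectionP hM Mep); split.
    by apply/funext => h /=; rewrite aps app.
  by move=> h k /=; rewrite apa supp_sym sap.
have pem : is_projection ip (am \o s).
  apply/(is_projectionP hM Mem); rewrite emE; split.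
    apply/funext => h; rewrite -[LHS]/(s (s h - ap (s h)) - ap (s (s h - ap (s h)))).
    by rewrite samsE (linopB (vn_linear hM Map) (s h)) app subrr subr0.
  by move=> h k; rewrite !fctE ipRBl ipRBr supp_sym /= apa supp_sym sap.
exists (ap \o s), (am \o s); split.
- split.
  + split => //; split; last first.
      move=> y [b Mb yE]; have My : M y by rewrite -yE; do 2!apply: (vn_comp hM) => //.
      rewrite cent_p // -[y \o (ap \o s)]/((y \o ap) \o s) absf_suppr //.
      exact: (vn_comp hM).
    by exists ap => //; apply/funext => h /=; rewrite aps.
  + split => //; split; last first.
      move=> y [b Mb yE]; have My : M y by rewrite -yE; do 2!apply: (vn_comp hM) => //.
      rewrite cent_m // -[y \o (am \o s)]/((y \o am) \o s) absf_suppr //.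
      exact: (vn_comp hM).
    exists am => //; apply/funext => h /=.
    by rewrite amsE samsE.
  + apply/funext => h /=; rewrite amsE samsE.
    by rewrite (linopB (vn_linear hM Map) (s h)) app subrr.
  + by rewrite emE addrC subrK.
- by rewrite absf_suppr.
- by rewrite absf_suppr.
- move=> y My; have Myv : M (y \o v) by exact: (vn_comp hM).
  rewrite psiE // /rmul /= (polarE (vn_comp hM Mep My)) (polarE (vn_comp hM Mem My)).
  rewrite -[((ap \o s) \o y) \o v]/((ap \o s) \o (y \o v)).
  rewrite -[((am \o s) \o y) \o v]/((am \o s) \o (y \o v)) cent_p // cent_m //.
  have h1 := half_r _ Myv.
  rewrite am_r // (linear_onB hM lw) //; last exact: (vn_comp hM).
  have -> : chi (y \o v) = (omega (y \o v) + chi (y \o v)) - omega (y \o v) by ring.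
  by rewrite -h1; ring.
Qed.
End NormEquation.

(** * Segments in the ball of the predual *)

Section Segments.
Context (R : realType) (H : completeNormedModType R[i]).
Context (ip : {dot H for @Num.conj R[i]}).
Context (M : set (H -> H)) (hM : von_neumann_algebra ip M).
Local Notation norm := (fnorm M).
Implicit Types (phi psi alpha beta : (H -> H) -> R[i]).

Lemma fnorm_scale (c : R[i]) phi : c != 0 -> predual ip M phi ->
  norm (fun x => c * phi x) = rnorm (c : R[i]^o) * norm phi.
Proof.
move=> c0 p; have q : predual ip M (fun x => c * phi x).
  by apply: (predual_eq hM _ (predual_lin c 0 p p)) => x _; rewrite mul0r addr0.
have cp : 0 < rnorm (c : R[i]^o) by rewrite -ltcR -rnormC normr_gt0.
apply/eqP; rewrite eq_le; apply/andP; split.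
  apply: (fnorm_le hM) => x Mx cx; rewrite rnormM ler_pM2l //.
  exact: le_fnorm p _ Mx cx.
rewrite -ler_pdivlMl //; apply: (fnorm_le hM) => x Mx cx.
by rewrite ler_pdivlMl // -rnormM; apply: le_fnorm q _ Mx cx.
Qed.

Lemma rnorm2 : rnorm (2 : R[i]^o) = 2.
Proof. by rewrite -(rmorph_nat (real_complex R)) rnorm_real ger0_norm. Qed.

(** The correspondence sends [psi] to the endpoints phi + psi and phi - psi, with inverse psi =
    (alpha - beta) / 2. *)
Lemma segment_normE (phi : (H -> H) -> R[i]) : predual ip M phi ->
  (exists alpha beta, [/\ predual ip M alpha, predual ip M beta,
      segment alpha beta `<=` predual_ball ip M (norm phi),
      norm (alpha \- beta) = 2 * norm phi & center_of_segment M phi alpha beta]) <->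
  (exists2 psi, predual ip M psi & [/\ norm (phi \+ psi) = norm phi,
      norm (phi \- psi) = norm phi & norm psi = norm phi]).
Proof.
move=> p; have two0 : (2 : R[i]) != 0 by rewrite pnatr_eq0.
split=> [[alpha [beta [pa pb seg nab cent]]]|[psi q [np nm nq]]]; last first.
  have qp := predual_add hM p q; have qm := predual_sub hM p q.
  exists (phi \+ psi), (phi \- psi); split; [exact: qp|exact: qm| | |].
  - move=> _ [t /= t01 <-]; split; first exact: (predual_lin _ _ qp qm).
    move: t01; rewrite in_itv /= => /andP[t0 t1].
    apply: (fnorm_le hM) => x Mx cx; apply: le_trans (@rnormD R R[i]^o _ _) _.
    rewrite !rnormM !rnorm_real !ger0_norm ?subr_ge0 //.
    have := le_fnorm qp Mx cx; have := le_fnorm qm Mx cx; rewrite np nm /=.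
    have : 0 <= 1 - t by rewrite subr_ge0.
    set a := rnorm _; set b := rnorm _; nra.
  - rewrite -nq -rnorm2 -(fnorm_scale two0 q); apply: fnorm_eq => x _ /=; ring.
  - by move=> x _ /=; field.
have na : norm alpha <= norm phi.
  have [|_] := seg alpha; last by [].
  exists 0; first by rewrite /= in_itv /= lexx ler01.
  by apply/funext => x; rewrite ?rmorph1 ?rmorph0 subr0 mul1r mul0r addr0.
have nb : norm beta <= norm phi.
  have [|_] := seg beta; last by [].
  exists 1; first by rewrite /= in_itv /= lexx ler01.
  by apply/funext => x; rewrite ?rmorph1 ?rmorph0 subrr mul1r mul0r add0r.
pose psi x := 2^-1 * alpha x + (- 2^-1) * beta x.
have q : predual ip M psi by exact: predual_lin.
have ep : eq_on M (phi \+ psi) alpha.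
  by move=> x Mx; rewrite /= /psi cent //; field.
have em : eq_on M (phi \- psi) beta.
  by move=> x Mx; rewrite /= /psi cent //; field.
have nq : norm psi = norm phi.
  have : norm (alpha \- beta) = 2 * norm psi.
    rewrite -rnorm2 -(fnorm_scale two0 q); apply: fnorm_eq => x _ /=.
    by rewrite /psi; field.
  by rewrite nab => /(mulfI _) -> //; rewrite pnatr_eq0.
(* The ball only bounds the endpoint norms from above; since 2 phi = alpha + beta, both must equal
   the norm of phi. *)
have nphi : 2 * norm phi <= norm alpha + norm beta.
  rewrite -rnorm2 -(fnorm_scale two0 p); apply: (fnorm_le hM) => x Mx cx.
  have -> : 2 * phi x = alpha x + beta x by rewrite cent //; field.
  apply: le_trans (@rnormD R R[i]^o _ _) _; apply: lerD.
    exact: le_fnorm pa _ Mx cx.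
  exact: le_fnorm pb _ Mx cx.
exists psi => //; split => //; first by rewrite (fnorm_eq ep); lra.
by rewrite (fnorm_eq em); lra.
Qed.
End Segments.


Theorem theorem2p5 (R : realType) (H : completeNormedModType R[i])
    (ip : {dot H for @Num.conj R[i]}) (hH : hilbert_norm ip)
    (M : set (H -> H)) (hM : von_neumann_algebra ip M)
    (phi : (H -> H) -> R[i]) (hphi : predual ip M phi)
    (phi_neq0 : ~ eq_on M phi (fun=> 0)) :
  let norm := fnorm M in
  let v := phase ip M phi in
  let omega := absf ip M phi in
  let s := supp ip M omega in
  let segment_condition :=
    exists alpha beta : (H -> H) -> R[i],
      [/\ predual ip M alpha, predual ip M beta,
          segment alpha beta `<=` predual_ball ip M (norm phi),
          norm (alpha \- beta) = 2 * norm phi &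
          center_of_segment M phi alpha beta] in
  let norm_equation := fun psi : (H -> H) -> R[i] =>
    [/\ norm (phi \+ psi) = norm phi,
        norm (phi \- psi) = norm phi &
        norm psi = norm phi] in
  let projection_condition := fun ep em : H -> H =>
    [/\ centralizer_splitting ip M omega ep em,
        omega ep = omega em,
        omega em = omega s / 2 &
        omega s / 2 = (norm phi / 2)%:C] in
  let psi_of := fun ep em : H -> H => rmul phi ep \- rmul phi em in
  [/\                   
      segment_condition <-> (exists2 psi, predual ip M psi & norm_equation psi),
                          
      (exists2 psi, predual ip M psi & norm_equation psi) <->
        (exists ep em, projection_condition ep em),
                                               
      forall ep em, projection_condition ep em ->
        [/\ predual ip M (psi_of ep em),
            norm_equation (psi_of ep em) &
            eq_on M (lmul (v \o (ep - em)) omega) (psi_of ep em)] &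
                                              
      forall psi, predual ip M psi ->
        (norm_equation psi <->
         exists ep em,
           [/\ centralizer_splitting ip M omega ep em,
               omega ep = (norm phi / 2)%:C,
               omega em = (norm phi / 2)%:C &
               eq_on M psi (psi_of ep em)])].

Proof.
move=> norm v omega s segment_condition norm_equation projection_condition psi_of.
have N0 : 0 < norm phi.
  rewrite lt_neqAle eq_sym (fnorm_ge0 hM hphi) andbT; apply/eqP => n0.
  exact: (phi_neq0 (fnorm_eq0 hM hphi n0)).
have half_split ep em : projection_condition ep em <->
    [/\ centralizer_splitting ip M omega ep em, omega ep = (norm phi / 2)%:C &
        omega em = (norm phi / 2)%:C].
  split=> [[sp -> -> ->]|[sp wp wm]] //.
  (* The last equation of the chain holds automatically, since omega(s) = omega(1) = N. *)
  have sE : omega s / 2 = (norm phi / 2)%:C.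
    have os : omega s = (norm phi)%:C.
      exact: etrans (absf_suppl hH hM hphi N0 (vn_id hM)) (absf_id hH hM hphi N0).
    by rewrite os; apply: complexP => /=; field.
  by split; rewrite ?wp ?wm ?sE.
have back ep em : projection_condition ep em ->
    [/\ predual ip M (psi_of ep em), norm_equation (psi_of ep em) &
        eq_on M (lmul (v \o (ep - em)) omega) (psi_of ep em)].
  by move=> /half_split[sp wp wm]; apply: (splitting_solution hH hM hphi N0).
split => //.
- exact: segment_normE.
- split=> [[psi q [np nm nq]]|[ep [em pc]]]; last first.
    by have [q ne _] := back _ _ pc; exists (psi_of ep em).
  have [ep [em [sp wp wm _]]] := norm_equation_splitting hH hM hphi N0 q np nm nq.
  by exists ep, em; apply/half_split.
- move=> psi q; split=> [[np nm nq]|[ep [em [sp wp wm e]]]].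
    exact: (norm_equation_splitting hH hM hphi N0 q np nm nq).
  have [_ [np nm nq] _] := back ep em ((half_split ep em).2 (And3 sp wp wm)).
  split; [rewrite -[RHS]np|rewrite -[RHS]nm|rewrite -[RHS]nq];
    by apply: fnorm_eq => x Mx /=; rewrite (e x Mx).
Qed.
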